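(* Let $f:\mathrm{Sym}_{++}(n)\to\mathbb R$ be twice continuously differentiable, let $P^\star\in\mathrm{Sym}_{++}(n)$ be a nondegenerate local minimizer of $f$, and let $\alpha\in\mathbb R$ with $\alpha\neq1$. Then $$\kappa(H_\alpha(P^\star))\ \ge\ \frac{\kappa(P^\star)^{2|\alpha-1|}}{\kappa(H_E(P^\star))}.$$ Consequently, if $$\kappa(P^\star)>\big(\sqrt2\,\kappa(H_E(P^\star))\big)^{1/|\alpha-1|},$$ then $\kappa(H_1(P^\star))<\kappa(H_\alpha(P^\star))$.
   Context: $\mathrm{Sym}(n)$ is the space of real symmetric $n\times n$ matrices with the Frobenius inner product $\langle X,Y\rangle_F=\mathrm{tr}(X^\top Y)$. $\mathrm{Sym}_{++}(n)$ is the manifold of symmetric positive definite matrices, with tangent spaces identified with $\mathrm{Sym}(n)$. Real powers, $\log$ and $\exp$ of matrices are defined by spectral calculus, and $(Df)(A)[E]$ denotes the Fréchet derivative of $f$ at $A$ in direction $E$. Alpha-Procrustes metric: for $P\in\mathrm{Sym}_{++}(n)$, $\alpha\in\mathbb R$ and $Y\in\mathrm{Sym}(n)$, $\mathcal L_{P,\alpha}(Y)$ is the unique $H\in\mathrm{Sym}(n)$ with $$(D\exp)(\log P)\circ(D\log)(P^{2\alpha})[HP^{2\alpha}+P^{2\alpha}H]=Y,$$ and $g^{(\alpha)}_P(X,Y)=4\,\mathrm{tr}\big(\mathcal L_{P,\alpha}(X)\,P^{2\alpha}\,\mathcal L_{P,\alpha}(Y)\big)$ for $X,Y\in\mathrm{Sym}(n)$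 (for $\alpha=0$ this is the Log-Euclidean metric). Euclidean gradient and Hessian: $\nabla f(P)\in\mathrm{Sym}(n)$ is defined by $\langle\nabla f(P),Y\rangle_F=(Df)(P)[Y]$, and $\nabla^2f(P)[Y]=(D(\nabla f))(P)[Y]$. A local minimizer $P^\star$ is nondegenerate if $\langle Y,\nabla^2 f(P^\star)[Y]\rangle_F>0$ for all nonzero $Y\in\mathrm{Sym}(n)$. The Riemannian gradient $\mathrm{grad}^{(\alpha)}f(P)$ is defined by $g^{(\alpha)}_P(\mathrm{grad}^{(\alpha)}f(P),Y)=(Df)(P)[Y]$, and the Riemannian Hessian is $\mathrm{Hess}^{(\alpha)}f(P)[Y]=\nabla^{(\alpha)}_Y\mathrm{grad}^{(\alpha)}f(P)$, where $\nabla^{(\alpha)}$ is the Levi-Civita connection of $g^{(\alpha)}$. Basis: write $P^\star=Q\Lambda Q^\top$ with $Q$ orthogonal and $\Lambda$ diagonal. $\mathcal B_{P^\star}$ is the Frobenius-orthonormal basis of $\mathrm{Sym}(n)$ consisting of $Qe_ie_i^\top Q^\top$ ($1\le i\le n$) and $\frac1{\sqrt2}Q(e_ie_j^\top+e_je_i^\top)Q^\top$ ($1\le i<j\le n$). $H_E(P^\star)$ and $H_\alpha(P^\star)$ are the matrices in the basis $\mathcal B_{P^\star}$ of $\nabla^2f(P^\star)$ and $\mathrm{Hess}^{(\alpha)}f(P^\star)$, respectively; $H_1(P^\star)$ is the case $\alpha=1$. These matrices, like $P^\star$, have real positive eigenvalues, and $\kappa$ of any of them denotes the ratio of the largest to the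 smallest eigenvalue. *)

(* Defs.v *)
From HB Require Import structures.
From mathcomp Require Import all_boot all_order all_algebra.
From mathcomp Require Import all_classical all_reals all_analysis.

Set Implicit Arguments.
Unset Strict Implicit.
Unset Printing Implicit Defensive.

Import Order.TTheory GRing.Theory Num.Theory.
Import numFieldNormedType.Exports.

Local Open Scope classical_set_scope.
Local Open Scope ring_scope.

(* Sym(n) is built as a type of its own with a normed module structure, so that
   the differential 'd of the library, applied to functions defined on it, is
   the Fréchet derivative along Sym(n). The norm is the restriction of the
   entrywise maximum norm of 'M[R]_n; the dimension being finite, this choice
   does not affect differentiability. *)
Definition issym (R : realType) (n : nat) : {pred 'M[R]_n} :=
  fun A => A^T == A.

Record Sym (R : realType) (n : nat) : Type :=
  MkSym { symval :> 'M[R]_n ; symvalP : symval \in @issym R n }.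

Section SymStructure.
Variables (R : realType) (n : nat).

Fact issymE (A : 'M[R]_n) : (A \in @issym R n) = (A^T == A).
Proof. by []. Qed.

Fact issym_submod_closed : submod_closed (@issym R n).
Proof.
split; first by rewrite issymE trmx0.
move=> a A B; rewrite !issymE => /eqP hA /eqP hB.
by rewrite linearP /= hA hB.
Qed.

HB.instance Definition _ :=
  GRing.isSubmodClosed.Build R 'M[R]_n (@issym R n) issym_submod_closed.
HB.instance Definition _ := [isSub for @symval R n].
HB.instance Definition _ := [Choice of Sym R n by <:].
HB.instance Definition _ := [SubChoice_isSubLmodule of Sym R n by <:].

Let symnorm (A : Sym R n) : R := `|val A|.

Fact symnormD A B : symnorm (A + B) <= symnorm A + symnorm B.
Proof. exact: ler_normD. Qed.

Fact symnormZ a A : symnorm (a *: A) = `|a| * symnorm A.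
Proof. exact: normrZ. Qed.

Fact symnorm0_eq0 A : symnorm A = 0 -> A = 0.
Proof. by move=> /normr0_eq0 h; apply: val_inj. Qed.

HB.instance Definition _ :=
  Lmodule_isNormed.Build R (Sym R n) symnormD symnormZ symnorm0_eq0.

End SymStructure.

Section SymMatrices.
Variables (R : realType) (n : nat).
Local Notation S := (Sym R n).

Definition frob (X Y : S) : R := \tr ((val X)^T *m val Y).

Definition SPD : set S :=
  [set P | forall v : 'cV[R]_n, v != 0 -> 0 < (v^T *m val P *m v) 0 0].

Definition is_spectral (A : S) (Q : 'M[R]_n) (d : 'rV[R]_n) : Prop :=
  Q *m Q^T = 1%:M /\ val A = Q *m diag_mx d *m Q^T.

(* [get] selects the element of a set with a unique element. Here the value does
   not depend on the choice of the diagonalization (Q, d) of A. *)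
Definition spectral_calculus (phi : R -> R) (A : S) : S :=
  get [set B : S | exists Q d, is_spectral A Q d /\
                     val B = Q *m diag_mx (map_mx phi d) *m Q^T].

Definition symexp : S -> S := spectral_calculus (@expR R).
Definition symlog : S -> S := spectral_calculus (@ln R).
Definition sympow (P : S) (a : R) : S := spectral_calculus (fun x => x `^ a) P.

Fact anticomm_sym (H A : S) : val H *m val A + val A *m val H \in @issym R n.
Proof.
rewrite issymE linearD /= !trmx_mul.
by rewrite (eqP (valP H)) (eqP (valP A)) addrC.
Qed.

Definition anticomm (H A : S) : S := MkSym (anticomm_sym H A).

Definition procrustes_L (a : R) (P Y : S) : S :=
  get [set H : S |
    'd symexp (symlog P)
      ('d symlog (sympow P (2 * a)) (anticomm H (sympow P (2 * a)))) = Y].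

Definition procrustes_metric (a : R) (P X Y : S) : R :=
  4 * \tr (val (procrustes_L a P X) *m val (sympow P (2 * a))
             *m val (procrustes_L a P Y)).

Definition euclid_grad (f : S -> R) (P : S) : S :=
  get [set G : S | forall Y : S, frob G Y = 'd f P Y].

Definition euclid_hess (f : S -> R) (P Y : S) : S := 'd (euclid_grad f) P Y.

(* In finite dimension, continuity of the second derivative in operator norm is
   continuity of its value on each pair of directions. *)
Definition twice_continuously_differentiable_on (U : set S) (f : S -> R) :
    Prop :=
  [/\ forall P, U P -> differentiable f P,
      forall P Y, U P -> differentiable (fun X => 'd f X Y : R) P
    & forall P Y Z, U P ->
        {for P, continuous (fun X => 'd (fun X' => 'd f X' Y : R) X Z : R)}].

Definition local_minimizer_on (U : set S) (f : S -> R) (P : S) : Prop :=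
  U P /\ \forall X \near P, U X -> f P <= f X.

Definition nondegenerate_at (f : S -> R) (P : S) : Prop :=
  forall Y : S, Y != 0 -> 0 < frob Y (euclid_hess f P Y).

(* On an open set U of Sym(n), vector fields are functions Z : S -> S, and a
   connection maps a point P, a tangent vector v at P and a vector field Z
   differentiable at P to the tangent vector (nabla_v Z)(P), written
   [nabla P v Z]. The bracket of Y and Z at P is DZ(P)[Y P] - DY(P)[Z P]. *)
Record is_levi_civita (U : set S) (g : S -> S -> S -> R)
    (nabla : S -> S -> (S -> S) -> S) : Prop := IsLeviCivita {
  connection_linear : forall (P : S) (c : R) (v w : S) (Z : S -> S), U P ->
    differentiable Z P ->
    nabla P (c *: v + w) Z = c *: nabla P v Z + nabla P w Z ;
  connection_additive : forall (P v : S) (Y Z : S -> S), U P ->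
    differentiable Y P -> differentiable Z P ->
    nabla P v (fun X => Y X + Z X) = nabla P v Y + nabla P v Z ;
  connection_leibniz : forall (P v : S) (h : S -> R) (Z : S -> S), U P ->
    differentiable h P -> differentiable Z P ->
    nabla P v (fun X => h X *: Z X) = ('d h P v : R) *: Z P + h P *: nabla P v Z ;
  torsion_free : forall (P : S) (Y Z : S -> S), U P ->
    differentiable Y P -> differentiable Z P ->
    nabla P (Y P) Z - nabla P (Z P) Y = 'd Z P (Y P) - 'd Y P (Z P) ;
  metric_compatible : forall (P v : S) (Y Z : S -> S), U P ->
    differentiable Y P -> differentiable Z P ->
    'd (fun X => g X (Y X) (Z X) : R) P v =
      g P (nabla P v Y) (Z P) + g P (Y P) (nabla P v Z) }.

Definition riem_grad (g : S -> S -> S -> R) (f : S -> R) (P : S) : S :=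
  get [set G : S | forall Y : S, g P G Y = 'd f P Y].

Definition riem_hess (g : S -> S -> S -> R) (nabla : S -> S -> (S -> S) -> S)
    (f : S -> R) (P Y : S) : S :=
  nabla P Y (riem_grad g f).

Definition eigenbasis_mx (Q : 'M[R]_n) (i j : 'I_n) : 'M[R]_n :=
  if i == j then Q *m delta_mx i i *m Q^T
  else (Num.sqrt 2)^-1 *: (Q *m (delta_mx i j + delta_mx j i) *m Q^T).

Fact eigenbasis_mx_sym Q i j : eigenbasis_mx Q i j \in @issym R n.
Proof.
rewrite issymE /eigenbasis_mx; case: ifP => _.
  by rewrite !trmx_mul trmx_delta trmxK mulmxA.
rewrite linearZ /= !trmx_mul linearD /= !trmx_delta trmxK mulmxA.
by rewrite (addrC (delta_mx j i)).
Qed.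

Definition eigenbasis (Q : 'M[R]_n) (i j : 'I_n) : S :=
  MkSym (eigenbasis_mx_sym Q i j).

Definition basis_index : {set 'I_n * 'I_n} :=
  [set p : 'I_n * 'I_n | (p.1 <= p.2)%N]%SET.

(* The basis is Frobenius-orthonormal for orthogonal Q, so the entries of the
   matrix of T are the Frobenius products <B_k, T B_l>. *)
Definition operator_mx (Q : 'M[R]_n) (T : S -> S) : 'M[R]_#|basis_index| :=
  \matrix_(k, l)
    frob (eigenbasis Q (enum_val k).1 (enum_val k).2)
         (T (eigenbasis Q (enum_val l).1 (enum_val l).2)).

End SymMatrices.

Arguments SPD {R n}.

(* The set of eigenvalues is finite, so sup and inf are its maximum and minimum
   when it is nonempty. Only eigenvalues in R are considered. *)
Definition kappa (R : realType) (m : nat) (A : 'M[R]_m) : R :=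
  sup [set x : R | eigenvalue A x] / inf [set x : R | eigenvalue A x].

(* Main.v *)
Require Import Defs.
From HB Require Import structures.
From mathcomp Require Import all_boot all_order all_algebra.
From mathcomp Require Import all_classical all_reals all_analysis.
From mathcomp Require Import ring lra.

Import Order.TTheory GRing.Theory Num.Theory.
Import numFieldNormedType.Exports.

Local Open Scope classical_set_scope.
Local Open Scope ring_scope.

Set Implicit Arguments.
Unset Strict Implicit.
Unset Printing Implicit Defensive.

(** At the critical point P of f, the Riemannian gradient vanishes, so for every
    torsion-free connection the Riemannian Hessian is the ordinary derivative of
    the field grad f = G^-1 (nabla f), that is G_P^-1 composed with the Euclidean
    Hessian ([covariant_derivative_at_zero], [diff_riem_grad]).

    The metric operator G_P is diagonal in the eigenbasis of P: by the
    Daleckii-Krein formula ([diff_spectral_calculus]) the differentials of the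
    matrix exponential and logarithm, hence the operator L of the
    alpha-Procrustes metric, act on the entries (i, j) in an eigenbasis by
    multiplication with a symbol evaluated at the eigenvalues (l_i, l_j).
    So the matrix of the Riemannian Hessian is diag(theta) H_E ([riem_hess_mx])
    where theta_ii = l_i^(2 (1 - alpha)), and where
    theta_ij = 2 (l_i^2 + l_j^2) / (l_i + l_j)^2 lies between 1 and 2 for
    alpha = 1 ([inverse_metric_symbol_diag], [inverse_metric_symbol1_bounds]).

    Since H_E is symmetric positive definite, diag(theta) H_E has the spectrum of
    diag(theta)^(1/2) H_E diag(theta)^(1/2), and Rayleigh quotients give
    kappa >= (theta_i / theta_j) / kappa(H_E) for all i, j, and
    kappa <= (max theta / min theta) kappa(H_E) ([kappa_scaling_ge],
    [kappa_scaling_le]). The first estimate at the diagonal entries of the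
    extremal eigenvalues of P is the lower bound. The second one gives
    kappa(H_1) <= 2 kappa(H_E), which the lower bound exceeds under the
    hypothesis of the second claim.

    Differentiability of functional calculi and continuity of the metric both
    rest on [schur_continuous]: the Schur multiplier with a continuous symbol,
    taken between the eigenbases of two matrices, depends continuously on these
    matrices even though the eigenbases do not. *)

(** * The real spectral theorem *)

Section Dot.
Variables (R : realType) (n : nat).
Implicit Types (x y z : 'rV[R]_n) (A : 'M[R]_n) (a : R).

Definition dot x y : R := (x *m y^T) 0 0.

Lemma dotE x y : dot x y = \sum_k x 0 k * y 0 k.
Proof. by rewrite /dot mxE; apply: eq_bigr => k _; rewrite mxE. Qed.

Lemma dotC x y : dot x y = dot y x.
Proof. by rewrite !dotE; apply: eq_bigr => k _; rewrite mulrC. Qed.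

Lemma dotDl x y z : dot (x + y) z = dot x z + dot y z.
Proof. by rewrite /dot mulmxDl mxE. Qed.

Lemma dotZl a x y : dot (a *: x) y = a * dot x y.
Proof. by rewrite /dot -scalemxAl mxE. Qed.

Lemma dotDr x y z : dot z (x + y) = dot z x + dot z y.
Proof. by rewrite dotC dotDl !(dotC z). Qed.

Lemma dotZr a x y : dot x (a *: y) = a * dot x y.
Proof. by rewrite dotC dotZl (dotC x). Qed.

Lemma dot0l x : dot 0 x = 0.
Proof. by rewrite /dot mul0mx mxE. Qed.

Lemma dot_ge0 x : 0 <= dot x x.
Proof. by rewrite dotE sumr_ge0// => k _; rewrite -expr2 sqr_ge0. Qed.

Lemma dot_eq0 x : dot x x = 0 -> x = 0.
Proof.
rewrite dotE => /eqP; rewrite psumr_eq0; last by move=> k _; rewrite -expr2 sqr_ge0.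
move=> /allP x0; apply/rowP => k; rewrite mxE.
by have /implyP/(_ isT) := x0 k (mem_index_enum k); rewrite mulf_eq0 orbb => /eqP.
Qed.

Lemma dot_gt0 x : x != 0 -> 0 < dot x x.
Proof.
by move=> x0; rewrite lt_neqAle dot_ge0 andbT eq_sym; apply: contra_neq x0 => /dot_eq0.
Qed.

Lemma dot_mulmx A x y : dot (x *m A) y = dot x (y *m A^T).
Proof. by rewrite /dot trmx_mul trmxK mulmxA. Qed.

Lemma dot_normalize x : x != 0 ->
  dot ((Num.sqrt (dot x x))^-1 *: x) ((Num.sqrt (dot x x))^-1 *: x) = 1.
Proof.
move=> x0; rewrite dotZl dotZr mulrA -expr2 exprVn sqr_sqrtr ?dot_ge0//.
by rewrite mulVf// gt_eqF// dot_gt0.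
Qed.

End Dot.

Section SpectralTheorem.
Variables (R : realType) (n : nat).
Implicit Types (x y z : 'rV[R]_n) (A B : 'M[R]_n).

(** First-order condition at a zero x of a form that is nonnegative on the
    orthogonal complement of the rows of V: the form would be negative at
    x - t (x B) for small t > 0 if x B were nonzero. *)
Lemma psd_isotropic_orthogonal m (V : 'M[R]_(m, n)) B x : B^T = B ->
    (forall z, z *m V^T = 0 -> 0 <= dot (z *m B) z) ->
    x *m V^T = 0 -> x *m B *m V^T = 0 -> dot (x *m B) x = 0 ->
  x *m B = 0.
Proof.
move=> Bsym Bge0 xV wV xBx; set w := x *m B in wV xBx *.
have b_ge0 := Bge0 _ wV; set b := dot (w *m B) w in b_ge0.
have q t : 0 <= - (2 * t * dot w w) + t ^+ 2 * b.
  have := Bge0 (x - t *: w); rewrite mulmxBl xV -scalemxAl wV scaler0 subrr => /(_ erefl).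
  rewrite mulmxBl -scalemxAl -/w -[- (t *: w)]scaleNr -[- (t *: (w *m B))]scaleNr.
  rewrite !(dotDl, dotDr, dotZl, dotZr) xBx -/b.
  have -> : dot (w *m B) x = dot w w by rewrite dot_mulmx Bsym.
  congr (_ <= _); ring.
apply: dot_eq0; apply/eqP; rewrite eq_le dot_ge0 andbT leNgt; apply/negP => a0.
set a := dot w w in a0 q.
have b1 : 0 < b + 1 by rewrite ltr_wpDl.
have := q (a / (b + 1)); rewrite leNgt => /negP; apply.
have -> : - (2 * (a / (b + 1)) * a) + (a / (b + 1)) ^+ 2 * b =
   - (a ^+ 2 * (b + 2) / (b + 1) ^+ 2) by field; rewrite gt_eqF.
rewrite oppr_lt0 divr_gt0// ?mulr_gt0// ?exprn_gt0//; lra.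
Qed.

Lemma dot_continuous A : continuous (fun x => dot (x *m A) x).
Proof.
have xA_continuous k : continuous (fun y : 'rV[R]_n => (y *m A) 0 k).
  under [X in continuous X]eq_fun => y do rewrite mxE.
  apply: continuous_big => [|j _ y]; first exact: add_continuous.
  by apply: (@cvgM _ _ (nbhs y)); [exact: coord_continuous|exact: cvg_cst].
under [X in continuous X]eq_fun => x do rewrite dotE.
apply: continuous_big => [|k _ x]; first exact: add_continuous.
by apply: (@cvgM _ _ (nbhs x)); [exact: xA_continuous|exact: coord_continuous].
Qed.

Lemma max_quadratic_form m (V : 'M[R]_(m, n)) A : (m < n)%N ->
  exists x, [/\ x *m V^T = 0, dot x x = 1 &
    forall z, z *m V^T = 0 -> dot (z *m A) z <= dot (x *m A) x * dot z z].
Proof.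
move=> mn; pose K := [set x : 'rV[R]_n | x *m V^T = 0 /\ dot x x = 1].
have [x0 x0K] : K !=set0.
  have : kermx V^T != 0.
    rewrite -mxrank_eq0 mxrank_ker subn_eq0 -ltnNge (leq_ltn_trans _ mn)//.
    exact: rank_leq_col.
  case/rowV0Pn => y /sub_kermxP yV y0.
  exists ((Num.sqrt (dot y y))^-1 *: y); split; last exact: dot_normalize.
  by rewrite -scalemxAl yV scaler0.
have Kcompact : compact K.
  apply: bounded_closed_compact.
    exists 1; split; first exact: num_real.
    move=> M M1 x [_ x1].
    rewrite /Num.norm/= mx_normrE; apply: bigmax_le => [|[i k] _/=].
      by rewrite (le_trans _ (ltW M1)).
    rewrite ord1 (le_trans _ (ltW M1))// -(@expr_le1 _ 2)// real_normK ?num_real//.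
    rewrite -x1 dotE (bigD1 k)//= expr2 lerDl sumr_ge0// => j _.
    by rewrite -expr2 sqr_ge0.
  (* Both constraints are quadratic: x V^T = 0 says that |x V^T|^2 = 0. *)
  have -> : K = (fun x => dot (x *m (V^T *m V)) x) @^-1` [set 0] `&`
                (fun x => dot (x *m 1%:M) x) @^-1` [set 1].
    have VV x : dot (x *m (V^T *m V)) x = dot (x *m V^T) (x *m V^T).
      by rewrite /dot trmx_mul trmxK !mulmxA.
    apply/seteqP; split=> x; rewrite /K/= VV mulmx1 => -[xV ->]; split=> //.
      by rewrite xV dot0l.
    exact: dot_eq0.
  by apply: closedI; (apply: preimage_closed; [move=> ? _; exact: dot_continuous|exact: closed_eq]).
have [|x xK xmax] := @EVT_max_rV _ _ (fun x => dot (x *m A) x) K (ex_intro _ _ x0K) Kcompact.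
  exact/continuous_subspaceT/dot_continuous.
move: xK; rewrite inE => -[xV x1]; exists x; split=> // z zV.
have [->|z0] := eqVneq z 0; first by rewrite mul0mx !dot0l mulr0.
have := dot_normalize z0; set c := (Num.sqrt (dot z z))^-1 => c1.
have := xmax (c *: z); rewrite inE => /(_ (conj _ c1)).
rewrite -scalemxAl zV scaler0 => /(_ erefl).
move: c1; rewrite -scalemxAl !(dotZl, dotZr) !mulrA -expr2 => c1 qz.
have c0 : 0 < c ^+ 2.
  rewrite lt_neqAle sqr_ge0 andbT; apply/eqP => c0; move: c1.
  by rewrite -c0 mul0r => /esym/eqP; rewrite oner_eq0.
by rewrite -(ler_pM2l c0) (le_trans qz)// mulrCA c1 mulr1.
Qed.

(** An orthonormal family of k eigenvectors extends by a maximizer of the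
    quadratic form on the unit sphere of its orthogonal complement. *)
Lemma orthonormal_eigenvectors A k : A^T = A -> (k <= n)%N ->
  exists (V : 'M[R]_(k, n)) d, V *m V^T = 1%:M /\ V *m A = diag_mx d *m V.
Proof.
move=> Asym; elim: k => [_|k IHk kn].
  by exists 0, 0; split; apply/matrixP => -[].
have [V [d [VV VA]]] := IHk (ltnW kn).
have [x [xV x1 xmax]] := max_quadratic_form V A kn.
set c := dot (x *m A) x in xmax.
have xA : x *m A = c *: x.
  apply/eqP; rewrite -subr_eq0 -opprB oppr_eq0; apply/eqP.
  rewrite -mul_mx_scalar -mulmxBr; apply: (@psd_isotropic_orthogonal _ V) => //.
  - by rewrite linearB/= Asym tr_scalar_mx.
  - move=> z zV; rewrite mulmxBr mul_mx_scalar -scaleN1r dotDl !dotZl mulN1r subr_ge0.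
    exact: xmax.
  - rewrite mulmxBr mul_mx_scalar mulmxBl -scalemxAl xV scaler0 sub0r.
    by rewrite -mulmxA -[A]Asym -trmx_mul VA trmx_mul mulmxA xV mul0mx oppr0.
  - by rewrite mulmxBr mul_mx_scalar -scaleN1r dotDl !dotZl x1 -/c mulr1 mulN1r subrr.
have orthonormal : col_mx x V *m (col_mx x V)^T = 1%:M :> 'M[R]_(1 + k).
  rewrite tr_col_mx mul_col_row VV xV -[V *m x^T]trmxK trmx_mul trmxK xV trmx0.
  by rewrite [x *m x^T]mx11_scalar -/(dot x x) x1 -scalar_mx_block.
have eigen : col_mx x V *m A = diag_mx (row_mx c%:M d) *m col_mx x V.
  rewrite mul_col_mx xA VA diag_mx_row mul_block_col !mul0mx addr0 add0r.
  rewrite -mul_scalar_mx; congr (col_mx (_ *m _) _).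
  by apply/matrixP => i j; rewrite !ord1 !mxE.
by exists (col_mx x V : 'M[R]_(1 + k, n)), (row_mx c%:M d : 'rV[R]_(1 + k)).
Qed.

Lemma spectral_theorem A : A^T = A ->
  exists (Q : 'M[R]_n) (d : 'rV[R]_n), Q *m Q^T = 1%:M /\ A = Q *m diag_mx d *m Q^T.
Proof.
move=> /orthonormal_eigenvectors/(_ (leqnn n))[V [d [VV VA]]].
have VtV := mulmx1C VV.
by exists V^T, d; rewrite trmxK; split=> //; rewrite -mulmxA -VA mulmxA VtV mul1mx.
Qed.

End SpectralTheorem.

(** * Condition numbers of symmetric matrices *)

Section ExtremalEigenvalues.
Variables (R : realType) (m : nat).
Implicit Types (M S Q : 'M[R]_m) (d u v : 'rV[R]_m).

Lemma eigenvalue_intertwined M S (r : 'M[R]_m) (x : R) : r \in unitmx ->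
  M *m r = r *m S -> eigenvalue M x = eigenvalue S x.
Proof.
move=> r_unit.
have intertwine A B q : q \in unitmx -> A *m q = q *m B ->
    eigenvalue A x -> eigenvalue B x.
  move=> q_unit AqB /eigenvalueP[v vA v0]; apply/eigenvalueP; exists (v *m q).
    by rewrite -mulmxA -AqB mulmxA vA -scalemxAl.
  by apply: contra_neq v0 => /(congr1 (mulmx^~ (invmx q))); rewrite mulmxK// mul0mx.
move=> MrS; apply/idP/idP; first exact: intertwine MrS.
apply: (intertwine _ S M (invmx r)); first by rewrite unitmx_inv.
by rewrite -[RHS]mulmx1 -(mulmxV r_unit) !mulmxA -(mulmxA (invmx r)) MrS !mulmxA mulVmx// mul1mx.
Qed.

Lemma eigenvalue_spectral Q d (x : R) : Q *m Q^T = 1%:M ->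
  eigenvalue (Q *m diag_mx d *m Q^T) x <-> exists i, x = d 0 i.
Proof.
move=> QQ; have QtQ := mulmx1C QQ.
rewrite (@eigenvalue_intertwined _ (diag_mx d) Q); first last.
- by rewrite -mulmxA QtQ mulmx1.
- by have [] := mulmx1_unit QQ.
split=> [/eigenvalueP[v vd v0]|[i ->]].
  have /rV0Pn[i vi0] := v0; exists i.
  move/rowP: vd => /(_ i); rewrite mul_mx_diag !mxE mulrC.
  by move/(mulIf vi0)/esym.
apply/eigenvalueP; exists (delta_mx 0 i).
  apply/rowP => j; rewrite mul_mx_diag !mxE eqxx/=.
  by have [->|] := eqVneq j i; rewrite ?mulr1 ?mul1r// mulr0 mul0r.
apply/rV0Pn; exists i; rewrite mxE !eqxx; exact: oner_neq0.
Qed.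

Hypothesis m_gt0 : (0 < m)%N.
Notation spectrum M := [set x : R | eigenvalue M x].

Lemma extremal_eigenvalues Q d : Q *m Q^T = 1%:M ->
  let M := Q *m diag_mx d *m Q^T in
  exists i j, [/\ sup (spectrum M) = d 0 i, inf (spectrum M) = d 0 j &
                  forall k, d 0 j <= d 0 k <= d 0 i].
Proof.
move=> QQ M.
pose i := [arg max_(i > Ordinal m_gt0) d 0 i]%O.
pose j := [arg min_(i < Ordinal m_gt0) d 0 i]%O.
have di k : d 0 k <= d 0 i by rewrite /i; case: arg_maxP => // i' _; exact.
have dj k : d 0 j <= d 0 k by rewrite /j; case: arg_minP => // i' _; exact.
have mem k : spectrum M (d 0 k) by apply/eigenvalue_spectral => //; exists k.
have le_i : ubound (spectrum M) (d 0 i) by move=> x /= /eigenvalue_spectral[]// k ->.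
have ge_j : lbound (spectrum M) (d 0 j) by move=> x /= /eigenvalue_spectral[]// k ->.
exists i, j; split=> [||k]; last by rewrite di dj.
- apply/eqP; rewrite eq_le ge_sup//=; last by exists (d 0 i).
  by apply: ub_le_sup => //; exists (d 0 i).
- apply/eqP; rewrite eq_le lb_le_inf// ?andbT; last by exists (d 0 i).
  by apply: ge_inf => //; exists (d 0 j).
Qed.

Lemma extremal_rayleigh M : M^T = M ->
  [/\ exists2 v, dot v v = 1 & dot (v *m M) v = sup (spectrum M),
      exists2 v, dot v v = 1 & dot (v *m M) v = inf (spectrum M) &
      forall v, inf (spectrum M) * dot v v <= dot (v *m M) v
                                           <= sup (spectrum M) * dot v v].
Proof.
move=> /spectral_theorem[Q [d [QQ MQ]]]; have QtQ := mulmx1C QQ.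
have [i [j]] := extremal_eigenvalues d QQ; rewrite -MQ => -[-> -> dij].
have dotQ v : dot (v *m Q) (v *m Q) = dot v v.
  by rewrite /dot trmx_mul mulmxA -(mulmxA v) QQ mulmx1.
have quad v : dot (v *m M) v = \sum_k d 0 k * (v *m Q) 0 k ^+ 2.
  rewrite MQ /dot !mulmxA -[_ *m _ *m v^T]mulmxA -trmx_mul -/(dot _ _) dotE.
  by apply: eq_bigr => k _; rewrite mul_mx_diag mxE; ring.
have eigenvec k : exists2 v, dot v v = 1 & dot (v *m M) v = d 0 k.
  exists (delta_mx 0 k *m Q^T).
    rewrite -dotQ -mulmxA QtQ mulmx1 dotE (bigD1 k)//= big1 ?addr0; last first.
      by move=> l lk; rewrite mxE (negPf lk) andbF mul0r.
    by rewrite mxE !eqxx mulr1.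
  rewrite quad -mulmxA QtQ mulmx1 (bigD1 k)//= big1 ?addr0; last first.
    by move=> l lk; rewrite mxE (negPf lk) andbF expr0n mulr0.
  by rewrite mxE !eqxx expr1n mulr1.
split=> // v; rewrite quad -dotQ dotE !mulr_sumr; apply/andP; split.
  apply: ler_sum => k _; rewrite -expr2 ler_wpM2r ?sqr_ge0//.
  by have /andP[] := dij k.
apply: ler_sum => k _; rewrite -expr2 ler_wpM2r ?sqr_ge0//.
by have /andP[] := dij k.
Qed.

Definition posdef M := forall v, v != 0 -> 0 < dot (v *m M) v.

Lemma posdef_spectrum_gt0 M : M^T = M -> posdef M -> 0 < inf (spectrum M).
Proof.
move=> Msym Mpos; have [_ [v v1 <-] _] := extremal_rayleigh Msym.
apply: Mpos; apply/eqP => v0; move: v1; rewrite v0 dot0l => /eqP.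
by rewrite eq_sym oner_eq0.
Qed.

Lemma inf_le_sup_spectrum M : M^T = M -> inf (spectrum M) <= sup (spectrum M).
Proof.
move=> /extremal_rayleigh[[v v1 _] _ /(_ v)/andP[le1 le2]].
by move: (le_trans le1 le2); rewrite v1 !mulr1.
Qed.

Lemma kappa_ge1 M : M^T = M -> posdef M -> 1 <= kappa M.
Proof.
move=> Msym Mpos.
by rewrite /kappa ler_pdivlMr ?mul1r ?inf_le_sup_spectrum ?posdef_spectrum_gt0.
Qed.

Lemma dot_delta (k : 'I_m) : dot (delta_mx 0 k) (delta_mx 0 k) = 1 :> R.
Proof.
rewrite dotE (bigD1 k)//= big1 => [|l lk]; first by rewrite mxE !eqxx mulr1 addr0.
by rewrite mxE (negPf lk) andbF mul0r.
Qed.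

Lemma dot_delta_mulmx M k : dot (delta_mx 0 k *m M) (delta_mx 0 k) = M k k.
Proof. by rewrite -rowE /dot trmx_delta -colE !mxE. Qed.

Lemma diag_spectrum_bounds M k : M^T = M ->
  inf (spectrum M) <= M k k <= sup (spectrum M).
Proof.
move=> /extremal_rayleigh[_ _ /(_ (delta_mx 0 k))].
by rewrite dot_delta !mulr1 dot_delta_mulmx.
Qed.

Section RowScaling.
Variables (S : 'M[R]_m) (theta : 'rV[R]_m).
Hypotheses (S_sym : S^T = S) (S_pos : posdef S).
Hypothesis theta_gt0 : forall k, 0 < theta 0 k.

(** The row scaling diag(theta) S has the eigenvalues of the symmetric matrix
    T = diag(theta)^(1/2) S diag(theta)^(1/2), to which Rayleigh quotients
    apply. *)
Lemma symmetrized_scaling : exists T r : 'M[R]_m,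
  [/\ T^T = T, posdef T, kappa (diag_mx theta *m S) = kappa T,
      forall v, dot (v *m T) v = dot (v *m r *m S) (v *m r) &
      (forall v, dot (v *m r) (v *m r) = \sum_k theta 0 k * v 0 k ^+ 2) /\
      forall k, T k k = theta 0 k * S k k].
Proof.
pose r := diag_mx (map_mx Num.sqrt theta); exists (r *m S *m r), r.
have r_unit : r \in unitmx.
  rewrite unitmxE det_diag unitfE; apply/prodf_neq0 => k _.
  by rewrite mxE gt_eqF// sqrtr_gt0.
have sqr_sqrt k : Num.sqrt (theta 0 k) * Num.sqrt (theta 0 k) = theta 0 k.
  by rewrite -expr2 sqr_sqrtr// ltW.
have dotT v : dot (v *m (r *m S *m r)) v = dot (v *m r *m S) (v *m r).
  by rewrite /dot trmx_mul /r tr_diag_mx !mulmxA.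
split.
- by rewrite !trmx_mul /r tr_diag_mx S_sym mulmxA.
- move=> v v0; rewrite dotT; apply: S_pos.
  by apply: contra_neq v0 => /(congr1 (mulmx^~ (invmx r))); rewrite mulmxK// mul0mx.
- rewrite /kappa; suff -> : spectrum (diag_mx theta *m S) = spectrum (r *m S *m r) by [].
  have rr : r *m r = diag_mx theta.
    by rewrite mulmx_diag; congr diag_mx; apply/rowP => k; rewrite !mxE sqr_sqrt.
  apply/seteqP; split=> x /=; rewrite (@eigenvalue_intertwined _ (r *m S *m r) r)//;
    by rewrite !mulmxA rr.
- exact: dotT.
split=> [v|k].
  rewrite dotE; apply: eq_bigr => k _.
  by rewrite mul_mx_diag !mxE mulrACA sqr_sqrt mulrC expr2.
by rewrite mul_mx_diag mul_diag_mx !mxE mulrAC sqr_sqrt.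
Qed.

(** The diagonal entries theta_i S_ii are Rayleigh quotients, and
    inf(S) <= S_ii <= sup(S). *)
Lemma kappa_scaling_ge i j : theta 0 i / theta 0 j / kappa S <= kappa (diag_mx theta *m S).
Proof.
have [T [r [T_sym T_pos -> _ [_ T_diag]]]] := symmetrized_scaling.
have infSpos := posdef_spectrum_gt0 S_sym S_pos.
have infTpos := posdef_spectrum_gt0 T_sym T_pos.
have /andP[Si_ge _] := diag_spectrum_bounds i S_sym.
have /andP[Sj_ge Sj_le] := diag_spectrum_bounds j S_sym.
have /andP[_] := diag_spectrum_bounds i T_sym.
have /andP[+ _] := diag_spectrum_bounds j T_sym.
rewrite !T_diag /kappa; have := theta_gt0 i; have := theta_gt0 j.
move: (theta 0 i) (theta 0 j) (S i i) (S j j) (sup (spectrum S)) (inf (spectrum S))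
  (sup (spectrum T)) (inf (spectrum T)) infSpos infTpos Si_ge Sj_ge Sj_le => ti tj si sj
  supS infS supT infT infS0 infT0 infSi infSj supSj tj0 ti0 infT_le supT_ge.
have supS0 : 0 < supS by rewrite (lt_le_trans infS0)// (le_trans infSj).
rewrite invf_div mulf_div ler_pdivrMr ?mulr_gt0// mulrAC ler_pdivlMr//.
apply: ler_pM; [by rewrite mulr_ge0// ltW|exact: ltW| |].
  by rewrite (le_trans _ supT_ge)// ler_pM2l.
by rewrite (le_trans infT_le)// ler_pM2l.
Qed.

Lemma kappa_scaling_le (a b : R) : 0 < a -> (forall k, a <= theta 0 k <= b) ->
  kappa (diag_mx theta *m S) <= b / a * kappa S.
Proof.
move=> a0 ab; have [T [r [T_sym T_pos -> dotT [dot_r _]]]] := symmetrized_scaling.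
have infSpos := posdef_spectrum_gt0 S_sym S_pos.
have infTpos := posdef_spectrum_gt0 T_sym T_pos.
have [_ _ rayS] := extremal_rayleigh S_sym.
have [[v v1 v_sup] [w w1 w_inf] _] := extremal_rayleigh T_sym.
have r_bounds u : dot u u = 1 -> a <= dot (u *m r) (u *m r) <= b.
  rewrite dotE dot_r => u1; apply/andP; split.
    rewrite -[leLHS]mulr1 -u1 mulr_sumr; apply: ler_sum => k _.
    by rewrite -expr2 ler_wpM2r ?sqr_ge0//; have /andP[] := ab k.
  rewrite -[leRHS]mulr1 -u1 mulr_sumr; apply: ler_sum => k _.
  by rewrite -expr2 ler_wpM2r ?sqr_ge0//; have /andP[] := ab k.
have /andP[av vb] := r_bounds v v1; have /andP[aw _] := r_bounds w w1.
have /andP[_] := rayS (v *m r); have /andP[+ _] := rayS (w *m r).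
rewrite -!dotT v_sup w_inf; have := inf_le_sup_spectrum S_sym.
have := inf_le_sup_spectrum T_sym; rewrite /kappa.
move: (dot (v *m r) (v *m r)) (dot (w *m r) (w *m r)) (sup (spectrum S))
  (inf (spectrum S)) (sup (spectrum T)) (inf (spectrum T)) infSpos infTpos av vb aw =>
  dv dw supS infS supT infT infS0 infT0 av vb aw leT leS infT_ge supT_le.
have supS0 : 0 < supS by exact: lt_le_trans leS.
have b0 : 0 < b by rewrite (lt_le_trans a0)// (le_trans av).
rewrite mulf_div ler_pdivrMr// mulrAC ler_pdivlMr ?mulr_gt0//.
apply: ler_pM; [by rewrite (le_trans _ leT)// ltW|by rewrite mulr_ge0// ltW| |].
  by rewrite (le_trans supT_le)// mulrC ler_pM2r.
by rewrite (le_trans _ infT_ge)// mulrC ler_pM2l.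
Qed.

End RowScaling.
End ExtremalEigenvalues.

(** * Schur multipliers between spectral decompositions *)

Section MatrixNorm.
Variables (R : realType) (n : nat).
Implicit Types (A B Q U : 'M[R]_n).

Lemma ler_mx_norm A i j : `|A i j| <= `|A|.
Proof.
by rewrite [leRHS]/Num.norm/= mx_normrE; apply: (le_bigmax _ _ (i, j)).
Qed.

Lemma mx_norm_le A (c : R) : 0 <= c -> (forall i j, `|A i j| <= c) -> `|A| <= c.
Proof.
move=> c0 Ac; rewrite [leLHS]/Num.norm/= mx_normrE.
by apply: bigmax_le => // -[i j] _; exact: Ac.
Qed.

Lemma mx_norm_mulmx A B : `|A *m B| <= n%:R * `|A| * `|B|.
Proof.
apply: mx_norm_le => [|i j]; first by rewrite !mulr_ge0.
rewrite mxE (le_trans (ler_norm_sum _ _ _))// -mulrA.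
rewrite mulr_natl -[X in _ *+ X]card_ord -sumr_const.
by apply: ler_sum => k _; rewrite normrM ler_pM// ler_mx_norm.
Qed.

Lemma orthogonal_sqr_sum Q i : Q *m Q^T = 1%:M -> \sum_k Q i k ^+ 2 = 1.
Proof.
move=> /matrixP/(_ i i); rewrite !mxE eqxx mulr1n => <-.
by apply: eq_bigr => k _; rewrite mxE expr2.
Qed.

Lemma orthogonal_tr Q : Q *m Q^T = 1%:M -> Q^T *m Q^T^T = 1%:M.
Proof. by move=> /mulmx1C; rewrite trmxK. Qed.

Lemma orthogonalM Q U : Q *m Q^T = 1%:M -> U *m U^T = 1%:M ->
  (Q *m U) *m (Q *m U)^T = 1%:M.
Proof. by move=> QQ UU; rewrite trmx_mul mulmxA -(mulmxA Q) UU mulmx1. Qed.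

Lemma orthogonal_entry_le1 Q i j : Q *m Q^T = 1%:M -> `|Q i j| <= 1.
Proof.
move=> QQ; rewrite -(@expr_le1 _ 2)// real_normK ?num_real//.
rewrite -(orthogonal_sqr_sum i QQ) (bigD1 j)//= lerDl sumr_ge0// => k _.
exact: sqr_ge0.
Qed.

Lemma orthogonal_norm_le1 Q : Q *m Q^T = 1%:M -> `|Q| <= 1.
Proof. by move=> QQ; apply: mx_norm_le => // i j; exact: orthogonal_entry_le1. Qed.

Lemma mx_norm_orthogonal Q U A : Q *m Q^T = 1%:M -> U *m U^T = 1%:M ->
  `|Q *m A *m U^T| <= n%:R ^+ 2 * `|A|.
Proof.
move=> QQ UU; rewrite (le_trans (mx_norm_mulmx _ _))// expr2 -!mulrA ler_wpM2l//.
have UT : `|U^T| <= 1 by apply/orthogonal_norm_le1/orthogonal_tr.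
rewrite (le_trans (ler_wpM2l _ UT))// mulr1 (le_trans (mx_norm_mulmx _ _))//.
by rewrite -mulrA ler_wpM2l// -[leRHS]mul1r ler_wpM2r// orthogonal_norm_le1.
Qed.

Lemma mx_norm_orthogonal_tr Q U A : Q *m Q^T = 1%:M -> U *m U^T = 1%:M ->
  `|Q^T *m A *m U| <= n%:R ^+ 2 * `|A|.
Proof.
move=> QQ UU; rewrite -{1}[U]trmxK.
by apply: mx_norm_orthogonal; exact: orthogonal_tr.
Qed.

End MatrixNorm.

Section SchurMultiplier.
Variables (R : realType) (n : nat).
Implicit Types (A B Q U K E W : 'M[R]_n) (l m : 'rV[R]_n).

Definition spec Q l : 'M[R]_n := Q *m diag_mx l *m Q^T.

(** The Schur (entrywise) multiplier K acting on E written in the bases given by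
    the columns of Q and U. *)
Definition schur Q U K E : 'M[R]_n :=
  Q *m (\matrix_(i, j) (K i j * (Q^T *m E *m U) i j)) *m U^T.

Definition kernel (phi : R -> R -> R) l m : 'M[R]_n :=
  \matrix_(i, j) phi (l 0 i) (m 0 j).

Lemma mixed_basisK Q U E : Q *m Q^T = 1%:M -> U *m U^T = 1%:M ->
  Q *m (Q^T *m E *m U) *m U^T = E.
Proof. by move=> QQ UU; rewrite !mulmxA QQ mul1mx -mulmxA UU mulmx1. Qed.

Lemma mul_spec Q l : Q *m Q^T = 1%:M -> spec Q l *m Q = Q *m diag_mx l.
Proof. by move=> QQ; rewrite /spec -mulmxA (mulmx1C QQ) mulmx1. Qed.

Lemma mul_tr_spec Q l : Q *m Q^T = 1%:M -> Q^T *m spec Q l = diag_mx l *m Q^T.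
Proof. by move=> QQ; rewrite /spec !mulmxA (mulmx1C QQ) mul1mx. Qed.

(** The eigenvector matrices intertwine differences of matrices with
    differences of eigenvalues. *)
Lemma spec_diff_entry Q l U m i j : Q *m Q^T = 1%:M -> U *m U^T = 1%:M ->
  (Q^T *m (spec U m - spec Q l) *m U) i j = (m 0 j - l 0 i) * (Q^T *m U) i j.
Proof.
move=> QQ UU; rewrite mulmxBr mulmxBl mul_tr_spec// -(mulmxA _ _ U) mul_spec//.
rewrite -(mulmxA _ _ U) (mulmxA _ U) mul_mx_diag mul_diag_mx !mxE; ring.
Qed.

(** If the two decompositions agree, (m_j - l_i) (Q^T U)_ij = 0, and therefore
    (phi(m_j) - phi(l_i)) (Q^T U)_ij = 0. *)
Lemma spec_inj_calculus (phi : R -> R) Q l U m :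
  Q *m Q^T = 1%:M -> U *m U^T = 1%:M -> spec Q l = spec U m ->
  spec Q (map_mx phi l) = spec U (map_mx phi m).
Proof.
move=> QQ UU lm.
have diag0 : Q^T *m (spec U (map_mx phi m) - spec Q (map_mx phi l)) *m U = 0.
  apply/matrixP => i j; rewrite spec_diff_entry// !mxE.
  have := spec_diff_entry l m i j QQ UU; rewrite lm subrr mulmx0 mul0mx mxE.
  move=> /esym/eqP; rewrite mulf_eq0 subr_eq0 => /orP[/eqP->|]; first by rewrite subrr mul0r.
  by rewrite mxE => /eqP->; rewrite mulr0.
apply/esym/eqP; rewrite -subr_eq0 -(mixed_basisK (_ - _) QQ UU) diag0.
by rewrite mulmx0 mul0mx.
Qed.

(** Löwner's identity: functional calculus increments are Schur multipliers with
    the divided differences as symbol, between the two eigenbases. *)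
Lemma calculus_diff (phi : R -> R) (dd : R -> R -> R) Q l U m :
    Q *m Q^T = 1%:M -> U *m U^T = 1%:M ->
    (forall x y, phi y - phi x = dd x y * (y - x)) ->
  spec U (map_mx phi m) - spec Q (map_mx phi l) =
  schur Q U (kernel dd l m) (spec U m - spec Q l).
Proof.
move=> QQ UU dphi; rewrite /schur.
have -> : \matrix_(i, j) (kernel dd l m i j * (Q^T *m (spec U m - spec Q l) *m U) i j) =
    Q^T *m (spec U (map_mx phi m) - spec Q (map_mx phi l)) *m U.
  apply/matrixP => i j; rewrite mxE !spec_diff_entry// !mxE mulrA.
  by rewrite -dphi.
exact/esym/mixed_basisK.
Qed.

Lemma schur_comp Q K K' E : Q *m Q^T = 1%:M ->
  schur Q Q K (schur Q Q K' E) = schur Q Q (\matrix_(i, j) (K i j * K' i j)) E.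
Proof.
move=> QQ; have QtQ := mulmx1C QQ.
rewrite /schur !mulmxA QtQ mul1mx -(mulmxA _ Q^T Q) QtQ mulmx1.
by congr (_ *m _ *m _); apply/matrixP => i j; rewrite !mxE mulrA.
Qed.

Lemma schur_norm Q U K E : Q *m Q^T = 1%:M -> U *m U^T = 1%:M ->
  `|schur Q U K E| <= n%:R ^+ 2 * (`|K| * (n%:R ^+ 2 * `|E|)).
Proof.
move=> QQ UU; rewrite (le_trans (mx_norm_orthogonal _ QQ UU))// ler_wpM2l ?sqr_ge0//.
apply: mx_norm_le => [|i j]; first by rewrite !mulr_ge0// sqr_ge0.
rewrite mxE normrM ler_pM ?ler_mx_norm// (le_trans (ler_mx_norm _ _ _))//.
exact: mx_norm_orthogonal_tr.
Qed.

Lemma schur_diff_entry Q U Q0 U0 K K0 E k h :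
    Q *m Q^T = 1%:M -> U *m U^T = 1%:M -> Q0 *m Q0^T = 1%:M -> U0 *m U0^T = 1%:M ->
  (Q0^T *m (schur Q U K E - schur Q0 U0 K0 E) *m U0) k h =
  \sum_i \sum_j (Q0^T *m Q) k i * (U0^T *m U) h j * (K i j - K0 k h) *
                (Q^T *m E *m U) i j.
Proof.
move=> QQ UU QQ0 UU0; set X := Q^T *m E *m U.
have entry (W Z Y : 'M[R]_n) : (W *m Y *m Z^T) k h = \sum_i \sum_j W k i * Z h j * Y i j.
  rewrite mxE exchange_big/=; apply: eq_bigr => j _; rewrite mxE mulr_suml.
  by apply: eq_bigr => i _; rewrite mxE mulrAC.
rewrite mulmxBr mulmxBl mxE [X in _ + X]mxE.
have -> : (Q0^T *m schur Q U K E *m U0) k h =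
    \sum_i \sum_j (Q0^T *m Q) k i * (U0^T *m U) h j * (K i j * X i j).
  rewrite -[RHS](_ : \sum_i \sum_j (Q0^T *m Q) k i * (U0^T *m U) h j *
     (\matrix_(i, j) (K i j * X i j)) i j = _); last first.
    by apply: eq_bigr => i _; apply: eq_bigr => j _; rewrite mxE.
  by rewrite -entry trmx_mul trmxK /schur !mulmxA.
have -> : (Q0^T *m schur Q0 U0 K0 E *m U0) k h =
    \sum_i \sum_j (Q0^T *m Q) k i * (U0^T *m U) h j * (K0 k h * X i j).
  rewrite /schur !mulmxA (mulmx1C QQ0) mul1mx -mulmxA (mulmx1C UU0) mulmx1 mxE.
  have -> : Q0^T *m E *m U0 = (Q0^T *m Q) *m X *m (U0^T *m U)^T.
    rewrite /X trmx_mul trmxK !mulmxA -(mulmxA _ U U^T) UU mulmx1.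
    by rewrite -(mulmxA _ Q Q^T) QQ mulmx1.
  rewrite entry mulr_sumr; apply: eq_bigr => i _; rewrite mulr_sumr.
  by apply: eq_bigr => j _; ring.
rewrite -sumrB; apply: eq_bigr => i _; rewrite -sumrB; apply: eq_bigr => j _.
ring.
Qed.

(** Eigenvectors of nearby matrices whose eigenvalues are not close are nearly
    orthogonal. *)
Lemma near_orthogonal_eigenvectors Q l Q0 l0 (rho s : R) i k :
    Q *m Q^T = 1%:M -> Q0 *m Q0^T = 1%:M ->
    0 < rho -> n%:R ^+ 2 * `|spec Q l - spec Q0 l0| <= s * rho ->
  `|l 0 i - l0 0 k| < rho \/ `|(Q0^T *m Q) k i| <= s.
Proof.
move=> QQ QQ0 rho0 close; have [?|far] := ltP `|l 0 i - l0 0 k| rho; [by left|right].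
have s0 : 0 <= s.
  by rewrite -(pmulr_lge0 _ rho0) (le_trans _ close)// mulr_ge0// sqr_ge0.
rewrite -(ler_pM2r rho0) (le_trans _ close)//.
rewrite (le_trans (ler_wpM2l (normr_ge0 _) far))//.
rewrite -normrM mulrC -spec_diff_entry// (le_trans (ler_mx_norm _ _ _))//.
exact: mx_norm_orthogonal_tr.
Qed.

(** The i-th column of the orthogonal matrix Q0^T Q is a unit vector, so not all
    of its entries are small. *)
Lemma near_eigenvalue Q l Q0 l0 (rho s : R) i :
    Q *m Q^T = 1%:M -> Q0 *m Q0^T = 1%:M ->
    0 < rho -> n%:R ^+ 2 * `|spec Q l - spec Q0 l0| <= s * rho ->
    n%:R * s ^+ 2 < 1 ->
  exists k, `|l 0 i - l0 0 k| < rho.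
Proof.
move=> QQ QQ0 rho0 close small; apply/not_existsP => far.
have W_small k : `|(Q0^T *m Q) k i| <= s.
  by have [/far|] := near_orthogonal_eigenvectors i k QQ QQ0 rho0 close.
have WW : (Q0^T *m Q)^T *m (Q0^T *m Q)^T^T = 1%:M.
  exact/orthogonal_tr/orthogonalM/QQ/orthogonal_tr.
move: small; apply/negP; rewrite -leNgt -[leLHS](orthogonal_sqr_sum i WW).
rewrite mulr_natl -[X in _ *+ X]card_ord -sumr_const; apply: ler_sum => k _.
by rewrite mxE -real_normK ?num_real// ler_pXn2r ?nnegrE// (le_trans _ (W_small k)).
Qed.

End SchurMultiplier.

Section SchurContinuity.
Variables (R : realType) (n : nat).
Implicit Types (Q U : 'M[R]_n) (l m : 'rV[R]_n) (phi : R -> R -> R).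

Lemma uniform_symbol_continuity phi l m (e : R) : 0 < e ->
    (forall i j, (fun p : R * R => phi p.1 p.2) @ (l 0 i, m 0 j) --> phi (l 0 i) (m 0 j)) ->
  exists2 rho : R, 0 < rho & forall i j (x y : R),
    `|x - l 0 i| < rho -> `|y - m 0 j| < rho ->
    `|phi x y - phi (l 0 i) (m 0 j)| < e.
Proof.
move=> e0 phi_cont.
have : \forall rho \near 0^'+, forall i j (x y : R),
    `|x - l 0 i| < rho -> `|y - m 0 j| < rho -> `|phi x y - phi (l 0 i) (m 0 j)| < e.
  apply: filter_forall => i; apply: filter_forall => j.
  have /cvgrPdist_lt/(_ e e0)/nbhs_ballP[r /= r0 hr] := phi_cont i j.
  near=> rho => x y xl ym.
  have rho_le : rho <= r by near: rho; exact: nbhs_right_le.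
  rewrite distrC; apply: (hr (x, y)); split; rewrite /ball/= distrC.
    exact: lt_le_trans xl rho_le.
  exact: lt_le_trans ym rho_le.
move=> near_rho.
have : \forall rho \near 0^'+, 0 < rho :> R by exact: nbhs_right_gt.
move=> /(filterI near_rho)/filter_ex[rho [Hrho rho0]].
by exists rho.
Unshelve. all: by end_near. Qed.

(** In the eigenbases of the limit matrices, the entry (k, h) of the difference
    of the two multipliers is a sum of terms
    W_ki Z_hj (phi(l_i, m_j) - phi(l0_k, m0_h)) X_ij with |W|, |Z| <= 1: either
    l_i and m_j are close to l0_k and m0_h, and the symbol varies little, or one
    of the factors W_ki, Z_hj is small. *)
Lemma schur_continuous phi Q0 l0 U0 m0 (e : R) :
    Q0 *m Q0^T = 1%:M -> U0 *m U0^T = 1%:M -> 0 < e ->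
    (forall i j, (fun p : R * R => phi p.1 p.2) @ (l0 0 i, m0 0 j) -->
                 phi (l0 0 i) (m0 0 j)) ->
  exists2 delta : R, 0 < delta & forall Q l U m, Q *m Q^T = 1%:M -> U *m U^T = 1%:M ->
    `|spec Q l - spec Q0 l0| < delta -> `|spec U m - spec U0 m0| < delta ->
    forall E, `|schur Q U (kernel phi l m) E - schur Q0 U0 (kernel phi l0 m0) E| <=
              e * `|E|.
Proof.
move=> QQ0 UU0 e0 phi_cont.
pose N : R := n%:R ^+ 2 + 1.
have N1 : 1 <= N by rewrite lerDr sqr_ge0.
have N0 : 0 < N by exact: lt_le_trans N1.
have nN : n%:R ^+ 2 <= N by rewrite lerDl.
(* Passing to the eigenbases and back, and estimating X, costs three factors
   n^2. *)
pose eta := Num.min 1 (e / N ^+ 3).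
have eta0 : 0 < eta by rewrite lt_min ltr01 divr_gt0// exprn_gt0.
have [rho rho0 phi_near] := uniform_symbol_continuity eta0 phi_cont.
pose M : R := \sum_k \sum_h `|phi (l0 0 k) (m0 0 h)|.
have M0 : 0 <= M by rewrite sumr_ge0// => k _; rewrite sumr_ge0.
have phi0_le k h : `|phi (l0 0 k) (m0 0 h)| <= M.
  rewrite /M (bigD1 k)//= (bigD1 h)//= -addrA lerDl addr_ge0//.
    by rewrite sumr_ge0.
  by rewrite sumr_ge0// => i _; rewrite sumr_ge0.
(* C bounds the variation of the symbol between eigenvalues of the nearby and of
   the limit matrices. *)
pose C : R := 2 * M + 1.
have C0 : 0 < C by rewrite ltr_wpDl// mulr_ge0.
pose s := Num.min (eta / C) (N^-1).
have s0 : 0 < s by rewrite lt_min divr_gt0//= invr_gt0.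
have s_eta : s * C <= eta by rewrite -ler_pdivlMr// ge_min lexx.
have s_N : s <= N^-1 by rewrite ge_min lexx orbT.
have s_small : n%:R * s ^+ 2 < 1.
  have n_lt_N : n%:R < N.
    by rewrite ltr_pwDr// -natrX ler_nat expnS expn1; case: (n) => // k; exact: leq_pmulr.
  have ns1 : n%:R * s < 1.
    by rewrite (le_lt_trans (ler_wpM2l _ s_N))// ltr_pdivrMr// mul1r.
  rewrite expr2 mulrA (le_lt_trans _ ns1)//.
  apply: ler_piMr; first by rewrite mulr_ge0// ltW.
  by rewrite (le_trans s_N)// invf_le1.
exists (s * rho / N); first by rewrite divr_gt0// mulr_gt0.
move=> Q l U m QQ UU Ql Um E.
have close (A : 'M[R]_n) : `|A| < s * rho / N -> n%:R ^+ 2 * `|A| <= s * rho :> R.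
  move=> /ltW A_le; rewrite (le_trans (ler_wpM2l (sqr_ge0 _) A_le))//.
  by rewrite mulrCA ger_pMr ?mulr_gt0// ler_pdivrMr ?mul1r.
have phi_le i j : `|phi (l 0 i) (m 0 j)| <= M + 1.
  have [k lk] := near_eigenvalue i QQ QQ0 rho0 (close _ Ql) s_small.
  have [h mh] := near_eigenvalue j UU UU0 rho0 (close _ Um) s_small.
  rewrite -[phi _ _](subrK (phi (l0 0 k) (m0 0 h))) addrC.
  rewrite (le_trans (ler_normD _ _))// lerD//.
  by rewrite ltW// (lt_le_trans (phi_near _ _ _ _ lk mh))// ge_min lexx.
have W_le1 k i : `|(Q0^T *m Q) k i| <= 1.
  exact/orthogonal_entry_le1/orthogonalM/QQ/orthogonal_tr.
have Z_le1 h j : `|(U0^T *m U) h j| <= 1.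
  exact/orthogonal_entry_le1/orthogonalM/UU/orthogonal_tr.
have term i j k h : `|(Q0^T *m Q) k i * (U0^T *m U) h j *
    (phi (l 0 i) (m 0 j) - phi (l0 0 k) (m0 0 h))| <= eta.
  have diff_le : `|phi (l 0 i) (m 0 j) - phi (l0 0 k) (m0 0 h)| <= C.
    rewrite (le_trans (ler_normB _ _))// (le_trans (lerD (phi_le i j) (phi0_le k h)))//.
    by rewrite /C; lra.
  rewrite !normrM.
  have [lk|Ws] := near_orthogonal_eigenvectors i k QQ QQ0 rho0 (close _ Ql); last first.
    rewrite (le_trans _ s_eta)// ler_pM ?mulr_ge0// -[s]mulr1.
    by rewrite ler_pM.
  have [mh|Zs] := near_orthogonal_eigenvectors j h UU UU0 rho0 (close _ Um); last first.
    rewrite (le_trans _ s_eta)// ler_pM ?mulr_ge0// -[s]mul1r.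
    by rewrite ler_pM.
  rewrite -[eta]mul1r ler_pM ?mulr_ge0// ?mulr_ile1//.
  exact/ltW/phi_near.
have diff_le : `|Q0^T *m (schur Q U (kernel phi l m) E -
    schur Q0 U0 (kernel phi l0 m0) E) *m U0| <= n%:R ^+ 2 * (eta * (n%:R ^+ 2 * `|E|)).
  apply: mx_norm_le => [|k h]; first by do 2!rewrite mulr_ge0 ?sqr_ge0 ?(ltW eta0)//.
  rewrite schur_diff_entry// (le_trans (ler_norm_sum _ _ _))//.
  rewrite expr2 -mulrA mulr_natl -[X in _ *+ X]card_ord -sumr_const; apply: ler_sum => i _.
  rewrite (le_trans (ler_norm_sum _ _ _))//.
  rewrite mulr_natl -[X in _ *+ X]card_ord -sumr_const; apply: ler_sum => j _.
  rewrite normrM ler_pM//.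
    by rewrite [kernel phi l m _ _]mxE [kernel phi l0 m0 _ _]mxE term.
  by rewrite (le_trans (ler_mx_norm _ _ _))// mx_norm_orthogonal_tr.
rewrite -[X in `|X|](mixed_basisK _ QQ0 UU0) (le_trans (mx_norm_orthogonal _ QQ0 UU0))//.
rewrite (le_trans (ler_wpM2l (sqr_ge0 _) diff_le))// !mulrA ler_wpM2r//.
have eta_e : eta * N ^+ 3 <= e by rewrite -ler_pdivlMr ?exprn_gt0// ge_min lexx orbT.
have n2_ge0 : 0 <= n%:R ^+ 2 :> R by exact: sqr_ge0.
move: eta_e n2_ge0 nN eta0; rewrite !exprS !expr0 !mulr1; set n2 := n%:R * n%:R.
move=> eta_e n2_ge0 nN eta0.
rewrite (le_trans _ eta_e)//.
rewrite [leLHS](_ : _ = eta * (n2 * (n2 * n2))); last by rewrite /n2; ring.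
by rewrite ler_wpM2l ?(ltW eta0)// !ler_pM ?mulr_ge0.
Qed.

End SchurContinuity.

(** * Differentiation of functional calculi *)

Section DividedDifference.
Variables (R : realType) (f f' : R -> R).

(** First divided difference, with the derivative on the diagonal. *)
Definition dd (x y : R) : R := if x == y then f' x else (f y - f x) / (y - x).

Lemma ddE x y : f y - f x = dd x y * (y - x).
Proof.
rewrite /dd; case: eqVneq => [->|xy]; first by rewrite !subrr mulr0.
by rewrite divfK// subr_eq0 eq_sym.
Qed.

Lemma dd_diag x : dd x x = f' x.
Proof. by rewrite /dd eqxx. Qed.

Lemma dd_sym x y : dd x y = dd y x.
Proof.
rewrite /dd eq_sym; case: eqVneq => [->//|_].
by rewrite -(opprB (f x)) -(opprB x) invrN mulrNN.
Qed.

Lemma dd_mean_value (x r a b : R) :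
    (forall z, `|z - x| < r -> is_derive (z : R) (1 : R) f (f' z)) ->
    `|a - x| < r -> `|b - x| < r ->
  exists2 c, `|c - x| < r & dd a b = f' c.
Proof.
move=> f_diff; wlog ab : a b / a < b => [hwlog ax bx|ax bx].
  have [ab|ba|->] := ltgtP a b; first exact: hwlog.
    by rewrite dd_sym; exact: hwlog.
  by exists b => //; rewrite dd_diag.
have between c : a <= c <= b -> `|c - x| < r.
  by move=> /andP[ac cb]; move: ax bx; rewrite !ltr_norml; lra.
have [||c cab f_eq] := @MVT _ f f' a b ab.
- move=> c; rewrite in_itv/= => /andP[ac cb]; apply/f_diff/between.
  by rewrite !ltW.
- apply: derivable_within_continuous => z; rewrite in_itv/= => /between zr.
  by have [] := f_diff _ zr.
exists c; first by apply: between; move: cab; rewrite in_itv/= => /andP[/ltW-> /ltW->].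
by rewrite /dd lt_eqF// f_eq mulfK// gt_eqF// subr_gt0.
Qed.

Lemma dd_continuous (x y : R) :
    (\forall z \near x, is_derive (z : R) (1 : R) f (f' z)) ->
    (\forall z \near y, is_derive (z : R) (1 : R) f (f' z)) ->
    f' @ x --> f' x ->
  (fun p : R * R => dd p.1 p.2) @ (x, y) --> dd x y.
Proof.
move=> fx fy f'x; have [yx|xy] := eqVneq x y.
  rewrite -yx dd_diag; apply/cvgrPdist_lt => e e0.
  have /cvgrPdist_lt/(_ e e0)/(filterI fx)/nbhs_ballP[r /= r0 hr] := f'x.
  exists (ball x r, ball x r) => [|[a b] [/=]]; first by split; exact: nbhsx_ballx.
  rewrite /ball/= => ax bx.
  rewrite distrC in ax; rewrite distrC in bx.
  have near_x z : `|z - x| < r -> is_derive (z : R) (1 : R) f (f' z) /\ `|f' x - f' z| < e.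
    by move=> zx; apply: hr; rewrite /ball/= distrC.
  have [c cx ->] := dd_mean_value (fun z zx => (near_x z zx).1) ax bx.
  exact: (near_x c cx).2.
have f_cont z : (\forall t \near z, is_derive (t : R) (1 : R) f (f' t)) -> f @ z --> f z.
  move=> /nbhs_singleton[/derivable1_diffP/differentiable_continuous]; exact.
have diff_cvg : (fun p : R * R => p.2 - p.1) @ (x, y) --> (y - x : R).
  by apply: cvgB; [exact: cvg_snd|exact: cvg_fst].
have yx0 : y - x != 0 by rewrite subr_eq0 eq_sym.
rewrite /dd (negPf xy).
have quotient_cvg : (fun p : R * R => (f p.2 - f p.1) / (p.2 - p.1)) @ (x, y) -->
    ((f y - f x) / (y - x) : R).
  apply: cvgM; last exact: cvgV.
  apply: cvgB; first exact: (cvg_comp snd f cvg_snd (f_cont y fy)).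
  exact: (cvg_comp fst f cvg_fst (f_cont x fx)).
apply: cvg_trans quotient_cvg; apply: near_eq_cvg.
have diff_neq0 : \forall p \near (x, y), p.2 - p.1 != 0 :> R.
  exact: cvgr_neq0 diff_cvg yx0.
near=> p; have : p.2 - p.1 != 0 :> R by near: p.
by rewrite subr_eq0 eq_sym => /negPf->.
Unshelve. all: by end_near.
Qed.

End DividedDifference.

Section SymOperators.
Variables (R : realType) (n : nat).
Local Notation S := (Sym R n).
Implicit Types (A B E K P : S) (Q U : 'M[R]_n) (l m : 'rV[R]_n).

Lemma sym_trmx A : (val A)^T = val A.
Proof. exact/eqP/(valP A). Qed.

Lemma spectral_exists A : exists Q l, is_spectral A Q l.
Proof. by have [Q [l [QQ AQ]]] := spectral_theorem (sym_trmx A); exists Q, l. Qed.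

Fact spec_sym Q l : spec Q l \in @issym R n.
Proof. by rewrite issymE /spec !trmx_mul trmxK tr_diag_mx mulmxA. Qed.

Definition specS Q l : S := MkSym (spec_sym Q l).

Lemma is_spectral_specS Q l : Q *m Q^T = 1%:M -> is_spectral (specS Q l) Q l.
Proof. by []. Qed.

Lemma spectral_calculusE (phi : R -> R) A Q l : is_spectral A Q l ->
  spectral_calculus phi A = specS Q (map_mx phi l).
Proof.
move=> AQ; pose V := [set B : S | exists Q d, is_spectral A Q d /\
                     val B = Q *m diag_mx (map_mx phi d) *m Q^T].
have /getPex : V !=set0 by exists (specS Q (map_mx phi l)), Q, l.
move=> -[U [m [[UU AU] getE]]]; apply: val_inj.
case: AQ => QQ AQ; rewrite -[LHS]/(val (get V)) getE.
by apply: spec_inj_calculus => //; rewrite -[LHS]AU -[RHS]AQ.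
Qed.

Lemma sym_entry A i j : val A i j = val A j i.
Proof. by rewrite -[in LHS](sym_trmx A) mxE. Qed.

Fact schur_sym Q K E : schur Q Q (val K) (val E) \in @issym R n.
Proof.
rewrite issymE /schur !trmx_mul trmxK mulmxA; apply/eqP; congr (_ *m _ *m _).
have : (Q^T *m val E *m Q)^T = Q^T *m val E *m Q.
  by rewrite !trmx_mul trmxK sym_trmx mulmxA.
move: (Q^T *m _ *m _) => X Xsym; apply/matrixP => i j; rewrite !mxE sym_entry.
by rewrite -[in LHS]Xsym mxE.
Qed.

Definition schurS Q K E : S := MkSym (schur_sym Q K E).

Fact schurS_linear Q K : linear (schurS Q K).
Proof.
move=> a E F; apply: val_inj; rewrite /= /schur.
rewrite scalemxAl -mulmxDl scalemxAr -mulmxDr; congr (_ *m _ *m _).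
have -> : Q^T *m val (a *: E + F) *m Q = a *: (Q^T *m val E *m Q) + Q^T *m val F *m Q.
  by rewrite [val (_ + _)]/= mulmxDr mulmxDl -scalemxAr -scalemxAl.
move: (Q^T *m val E *m _) (Q^T *m val F *m _) => X Y.
by apply/matrixP => i j; rewrite !mxE; ring.
Qed.

HB.instance Definition _ Q K :=
  GRing.isLinear.Build R S S *:%R (schurS Q K) (schurS_linear Q K).

Fact kernel_sym (phi : R -> R -> R) (phiC : forall x y, phi x y = phi y x) l :
  kernel phi l l \in @issym R n.
Proof. by rewrite issymE; apply/eqP/matrixP => i j; rewrite !mxE phiC. Qed.

Definition kernelS phi phiC l : S := MkSym (@kernel_sym phi phiC l).

Lemma schurS_comp Q K K' K'' E : Q *m Q^T = 1%:M ->
    (forall i j, val K'' i j = val K i j * val K' i j) ->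
  schurS Q K (schurS Q K' E) = schurS Q K'' E.
Proof.
move=> QQ KK; apply: val_inj; rewrite /= schur_comp//; congr schur.
by apply/matrixP => i j; rewrite mxE KK.
Qed.

Lemma schurS_1 Q K E : Q *m Q^T = 1%:M -> (forall i j, val K i j = 1) -> schurS Q K E = E.
Proof.
move=> QQ K1; apply: val_inj; rewrite /= -[RHS](mixed_basisK (val E) QQ QQ).
by congr (_ *m _ *m _); apply/matrixP => i j; rewrite mxE K1 mul1r.
Qed.

Lemma sym_normE A : `|A| = `|val A|.
Proof. by []. Qed.

Lemma diff_of_expansion (V W : normedModType R) (F : V -> W) (x : V) (dF : {linear V -> W})
    (C : R) :
    (forall h, `|dF h| <= C * `|h|) ->
    (forall e, 0 < e -> \forall h \near 0, `|F (h + x) - F x - dF h| <= e * `|h|) ->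
  differentiable F x /\ 'd F x = dF :> (V -> W).
Proof.
move=> dF_bound expansion.
have dF_cont : continuous dF.
  apply: bounded_linear_continuous; apply/linear_boundedP; near=> r => h.
  by rewrite (le_trans (dF_bound h))// ler_wpM2r//; near: r; exact: nbhs_pinfty_ge.
have F_expansion : F \o shift x = cst (F x) + dF +o_ 0 id.
  apply/eqaddoP => e e0; have := expansion e e0; apply: filterS => h.
  by rewrite /= !fctE /= opprD addrA.
have dFE := diff_unique dF_cont F_expansion.
by split=> //; apply/diff_locallyP; rewrite dFE.
Unshelve. all: by end_near. Qed.

(** The Daleckii-Krein formula. By Löwner's identity the increment at A + h is the
    multiplier by divided differences between the eigenbases of A and A + h,
    applied to h; it tends to the multiplier in the eigenbasis of A. *)
Lemma diff_spectral_calculus (phi phi' : R -> R) A Q l : is_spectral A Q l ->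
    (forall i, \forall z \near l 0 i, is_derive (z : R) (1 : R) phi (phi' z)) ->
    (forall i, phi' @ (l 0 i) --> phi' (l 0 i)) ->
  'd (spectral_calculus phi) A = schurS Q (kernelS (dd_sym phi phi') l) :> (S -> S).
Proof.
move=> AQ phi_diff phi'_cont; have [QQ AE] := AQ.
apply: proj2; apply: (@diff_of_expansion _ _ _ _ _
  (n%:R ^+ 2 * (`|kernel (dd phi phi') l l| * n%:R ^+ 2))) => [h|e e0].
  by rewrite !sym_normE (le_trans (schur_norm _ _ QQ QQ))// !mulrA.
have [i j|delta delta0 close] := @schur_continuous R n (dd phi phi') Q l Q l e QQ QQ e0.
  exact: dd_continuous.
apply/nbhs_norm0P; exists delta => //= h h_small.
have [U [m [UU AhE]]] := spectral_exists (h + A).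
rewrite (spectral_calculusE _ AQ) (spectral_calculusE _ (conj UU AhE)) !sym_normE.
have hE : val h = spec U m - spec Q l by rewrite /spec -AhE -AE /= addrK.
rewrite -[val _]/(spec U (map_mx phi m) - spec Q (map_mx phi l) - schur Q Q _ (val h)).
rewrite (calculus_diff _ _ QQ UU (@ddE _ phi phi')) -hE.
apply: close => //; first by rewrite subrr normr0.
by rewrite -hE -sym_normE.
Qed.

End SymOperators.

(** * The alpha-Procrustes metric in an eigenbasis *)

Section FrobeniusProduct.
Variables (R : realType) (n : nat).
Local Notation S := (Sym R n).
Implicit Types (A G H K P X Y : S) (Q U : 'M[R]_n) (l m : 'rV[R]_n).

Lemma frobE X Y : frob X Y = \sum_i \sum_j val X i j * val Y i j.
Proof.
rewrite /frob /mxtrace exchange_big/=; apply: eq_bigr => j _.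
by rewrite mxE; apply: eq_bigr => i _; rewrite mxE.
Qed.

Lemma frobC X Y : frob X Y = frob Y X.
Proof.
by rewrite !frobE; apply: eq_bigr => i _; apply: eq_bigr => j _; rewrite mulrC.
Qed.

Fact frob_linear X : linear (frob X : S -> R^o).
Proof.
move=> a Y Z; rewrite !frobE scaler_sumr -big_split/=; apply: eq_bigr => i _.
rewrite scaler_sumr -big_split/=; apply: eq_bigr => j _.
by rewrite !mxE [a *: _]mulrCA mulrDr.
Qed.

HB.instance Definition _ X := GRing.isLinear.Build R S R^o *:%R (frob X) (frob_linear X).

Lemma frob_eq0 X : frob X X = 0 -> X = 0.
Proof.
rewrite frobE => /eqP; rewrite psumr_eq0 => [/allP X0|i _]; last first.
  by rewrite sumr_ge0// => j _; rewrite -expr2 sqr_ge0.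
apply/val_inj/matrixP => i j; rewrite [RHS]mxE.
have /implyP/(_ isT) := X0 i (mem_index_enum i).
rewrite psumr_eq0 => [/allP/(_ j (mem_index_enum j))/implyP/(_ isT)|k _].
  by rewrite mulf_eq0 orbb => /eqP.
by rewrite -expr2 sqr_ge0.
Qed.

Lemma frob_inj G H : (forall Y, frob G Y = frob H Y) -> G = H.
Proof.
move=> GH; apply/eqP; rewrite -subr_eq0; apply/eqP/frob_eq0.
by rewrite linearB/= frobC [frob _ H]frobC !GH subrr.
Qed.

(** The matrix of X in the basis of the columns of Q. *)
Definition rotated Q X : 'M[R]_n := Q^T *m val X *m Q.

Lemma rotated_sym Q X i j : rotated Q X i j = rotated Q X j i.
Proof.
rewrite -[in RHS](_ : (rotated Q X)^T = rotated Q X); first by rewrite [RHS]mxE.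
by rewrite /rotated !trmx_mul trmxK sym_trmx mulmxA.
Qed.

Lemma rotated_schur Q K X i j : Q *m Q^T = 1%:M ->
  rotated Q (schurS Q K X) i j = val K i j * rotated Q X i j.
Proof.
move=> QQ; rewrite /rotated /= /schur !mulmxA (mulmx1C QQ) mul1mx.
by rewrite -mulmxA (mulmx1C QQ) mulmx1 mxE.
Qed.

Lemma mxtrace_rotated Q (A B : 'M[R]_n) : Q *m Q^T = 1%:M ->
  \tr (A *m B) = \tr ((Q^T *m A *m Q) *m (Q^T *m B *m Q)).
Proof.
move=> QQ; rewrite !mulmxA -(mulmxA _ Q) QQ mulmx1 -!mulmxA [RHS]mxtrace_mulC.
by rewrite -!mulmxA QQ mulmx1.
Qed.

Lemma mxtrace_mul (A B : 'M[R]_n) : \tr (A *m B) = \sum_i \sum_j A i j * B j i.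
Proof. by rewrite /mxtrace; apply: eq_bigr => i _; rewrite mxE. Qed.

Lemma frob_rotated Q X Y : Q *m Q^T = 1%:M ->
  frob X Y = \sum_i \sum_j rotated Q X i j * rotated Q Y i j.
Proof.
move=> QQ; rewrite /frob sym_trmx (mxtrace_rotated _ _ QQ) mxtrace_mul.
apply: eq_bigr => i _; apply: eq_bigr => j _.
by rewrite -[X in _ * X]/(rotated Q Y j i) rotated_sym.
Qed.

Lemma frob_schur Q K X Y : Q *m Q^T = 1%:M ->
  frob X (schurS Q K Y) = \sum_i \sum_j val K i j * (rotated Q X i j * rotated Q Y i j).
Proof.
move=> QQ; rewrite (frob_rotated _ _ QQ); apply: eq_bigr => i _; apply: eq_bigr => j _.
by rewrite rotated_schur// mulrCA.
Qed.

Lemma anticomm_schur (psi : R -> R -> R) (psiC : forall x y, psi x y = psi y x) Q l m H :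
    Q *m Q^T = 1%:M -> (forall i j, psi (l 0 i) (l 0 j) = m 0 i + m 0 j) ->
  anticomm H (specS Q m) = schurS Q (kernelS psiC l) H.
Proof.
move=> QQ psiE; apply: val_inj; rewrite -[LHS](mixed_basisK _ QQ QQ) /=.
rewrite -[X in Q^T *m X]/(val H *m spec Q m + spec Q m *m val H).
have -> : Q^T *m (val H *m spec Q m + spec Q m *m val H) *m Q =
    rotated Q H *m diag_mx m + diag_mx m *m rotated Q H.
  rewrite mulmxDr mulmxDl; congr (_ + _).
    by rewrite -[LHS]mulmxA -(mulmxA (val H)) mul_spec// /rotated !mulmxA.
  by rewrite (mulmxA Q^T) mul_tr_spec// /rotated !mulmxA.
congr (_ *m _ *m _); rewrite mul_mx_diag mul_diag_mx -/(rotated Q H).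
by apply/matrixP => i j; move: (rotated Q H) => X; rewrite !mxE psiE; ring.
Qed.

Lemma SPD_spectral P Q l : is_spectral P Q l -> SPD P <-> forall i, 0 < l 0 i.
Proof.
move=> [QQ PE]; have QtQ := mulmx1C QQ.
have quad (v : 'cV[R]_n) : (v^T *m val P *m v) 0 0 = \sum_i l 0 i * (Q^T *m v) i 0 ^+ 2.
  rewrite PE !mulmxA -[_ *m _ *m Q^T *m v]mulmxA -[v^T *m Q]trmxK trmx_mul trmxK.
  rewrite mul_mx_diag mxE; apply: eq_bigr => i _.
  by move: (Q^T *m v) => w; rewrite !mxE; ring.
split=> [P_pos i|l_pos v v0].
  pose v : 'cV[R]_n := Q *m delta_mx i 0.
  have : 0 < (v^T *m val P *m v) 0 0.
    apply: (P_pos v); apply/eqP => /(congr1 (mulmx Q^T)).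
    rewrite mulmxA QtQ mul1mx mulmx0 => /matrixP/(_ i 0).
    by rewrite !mxE !eqxx => /eqP; rewrite oner_eq0.
  rewrite quad /v mulmxA QtQ mul1mx (bigD1 i)//= big1 ?addr0 => [|j ji].
    by rewrite mxE !eqxx expr1n mulr1.
  by rewrite mxE (negPf ji) expr0n mulr0.
rewrite quad.
have terms_ge0 i : 0 <= l 0 i * (Q^T *m v) i 0 ^+ 2.
  by rewrite mulr_ge0 ?sqr_ge0// ltW.
rewrite lt_neqAle sumr_ge0// andbT eq_sym; apply: contra_neq v0 => /eqP.
rewrite psumr_eq0// => /allP Qv0.
rewrite -[v]mul1mx -QQ -mulmxA [Q^T *m v](_ : _ = 0) ?mulmx0//.
apply/colP => i; rewrite [RHS]mxE; have /implyP/(_ isT) := Qv0 i (mem_index_enum i).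
by rewrite mulf_eq0 gt_eqF//= sqrf_eq0 => /eqP.
Qed.

End FrobeniusProduct.

Section ProcrustesSymbol.
Variables (R : realType) (a : R).
Implicit Types (x y : R).

(** The three factors are the symbols, at eigenvalues x and y of P, of the
    differential of exp at log P, of the differential of log at P^(2a), and of
    H |-> H P^(2a) + P^(2a) H. *)
Definition procrustes_symbol x y : R :=
  dd expR expR (ln x) (ln y) *
  (dd (@ln R) (fun x => x^-1) (x `^ (2 * a)) (y `^ (2 * a)) *
   (x `^ (2 * a) + y `^ (2 * a))).

Lemma procrustes_symbolC x y : procrustes_symbol x y = procrustes_symbol y x.
Proof.
by rewrite /procrustes_symbol dd_sym (dd_sym (@ln R)) [in X in _ * X]addrC.
Qed.

Lemma dd_gt0 (f f' : R -> R) x y : (x < y -> f x < f y) -> (y < x -> f y < f x) ->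
  0 < f' x -> 0 < dd f f' x y.
Proof.
move=> fxy fyx f'x; have := ddE f f' x y; have [xy|yx|<- _] := ltgtP x y.
- move=> f_eq; have : 0 < f y - f x by rewrite subr_gt0 fxy.
  by rewrite f_eq pmulr_lgt0// subr_gt0.
- move=> f_eq; have : f y - f x < 0 by rewrite subr_lt0 fyx.
  by rewrite f_eq nmulr_llt0// subr_lt0.
- by rewrite dd_diag.
Qed.

Lemma dd_expR_gt0 x y : 0 < dd expR expR x y.
Proof. by apply: dd_gt0; rewrite ?ltr_expR ?expR_gt0. Qed.

Lemma dd_ln_gt0 x y : 0 < x -> 0 < y -> 0 < dd (@ln R) (fun x => x^-1) x y.
Proof. by move=> x0 y0; apply: dd_gt0; rewrite ?ltr_ln ?posrE ?invr_gt0. Qed.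

Lemma procrustes_symbol_gt0 x y : 0 < x -> 0 < y -> 0 < procrustes_symbol x y.
Proof.
move=> x0 y0; rewrite !mulr_gt0 ?dd_expR_gt0 ?dd_ln_gt0 ?addr_gt0//; exact: powR_gt0.
Qed.

Lemma procrustes_symbol_diag x : 0 < x -> procrustes_symbol x x = 2 * x.
Proof.
move=> x0; rewrite /procrustes_symbol !dd_diag lnK ?posrE//.
by field; rewrite gt_eqF// powR_gt0.
Qed.

Lemma near_derive_expR x : \forall z \near x, is_derive (z : R) (1 : R) expR (expR z).
Proof. by near=> z; exact: is_derive_expR. Unshelve. all: by end_near. Qed.

Lemma near_derive_ln x : 0 < x -> \forall z \near x, is_derive (z : R) (1 : R) (@ln R) z^-1.
Proof.
move=> x0; near=> z; apply: is_derive1_ln; near: z; exact: lt_nbhsr.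
Unshelve. all: by end_near. Qed.

Lemma powR_continuous (b x : R) : 0 < x -> (fun z => z `^ b) @ x --> x `^ b.
Proof.
move=> x0; have [/derivable1_diffP/differentiable_continuous] := is_derive1_powR b x0.
exact.
Qed.

(** In the eigenbasis of P the metric multiplies the entry at eigenvalues x and y
    by the reciprocal of this number. *)
Definition inverse_metric_symbol x y : R :=
  procrustes_symbol x y ^+ 2 / (2 * (x `^ (2 * a) + y `^ (2 * a))).

Lemma inverse_metric_symbolC x y : inverse_metric_symbol x y = inverse_metric_symbol y x.
Proof. by rewrite /inverse_metric_symbol procrustes_symbolC addrC. Qed.

Lemma inverse_metric_symbol_gt0 x y : 0 < x -> 0 < y -> 0 < inverse_metric_symbol x y.
Proof.
move=> x0 y0; rewrite divr_gt0 ?exprn_gt0 ?procrustes_symbol_gt0//.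
by rewrite mulr_gt0// addr_gt0// powR_gt0.
Qed.

Lemma inverse_metric_symbol_diag x : 0 < x ->
  inverse_metric_symbol x x = x `^ (2 * (1 - a)).
Proof.
move=> x0; rewrite /inverse_metric_symbol procrustes_symbol_diag// mulrBr mulr1.
rewrite powRB ?(gt_eqF x0) ?implybT// powR_mulrn ?ltW//.
have p0 := powR_gt0 (2 * a) x0.
by field; rewrite !gt_eqF// addr_gt0.
Qed.

Lemma inverse_metric_symbol_continuous x y : 0 < x -> 0 < y ->
  (fun p : R * R => inverse_metric_symbol p.1 p.2) @ (x, y) --> inverse_metric_symbol x y.
Proof.
move=> x0 y0.
have pow1 : (fun p : R * R => p.1 `^ (2 * a)) @ (x, y) --> x `^ (2 * a).
  exact: (cvg_comp fst (fun z => z `^ (2 * a)) cvg_fst (powR_continuous x0)).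
have pow2 : (fun p : R * R => p.2 `^ (2 * a)) @ (x, y) --> y `^ (2 * a).
  exact: (cvg_comp snd (fun z => z `^ (2 * a)) cvg_snd (powR_continuous y0)).
have pow_sum : (fun p : R * R => p.1 `^ (2 * a) + p.2 `^ (2 * a)) @ (x, y) -->
    x `^ (2 * a) + y `^ (2 * a) by exact: cvgD.
have symbol_cvg : (fun p : R * R => procrustes_symbol p.1 p.2) @ (x, y) -->
    procrustes_symbol x y.
  apply: cvgM; last apply: cvgM => //.
    have lns : (fun p : R * R => (ln p.1, ln p.2)) @ (x, y) --> (ln x, ln y).
      exact: (cvg_pair (cvg_comp fst (@ln R) cvg_fst (continuous_ln x0))
                       (cvg_comp snd (@ln R) cvg_snd (continuous_ln y0))).
    apply: (cvg_comp _ (fun p : R * R => dd expR expR p.1 p.2) lns); apply: dd_continuous.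
    + exact: near_derive_expR.
    + exact: near_derive_expR.
    + exact: continuous_expR.
  have pows : (fun p : R * R => (p.1 `^ (2 * a), p.2 `^ (2 * a))) @ (x, y) -->
      (x `^ (2 * a), y `^ (2 * a)) by exact: (cvg_pair pow1 pow2).
  apply: (cvg_comp _ (fun p : R * R => dd (@ln R) (fun x => x^-1) p.1 p.2) pows).
  apply: dd_continuous.
  - by apply: near_derive_ln; exact: powR_gt0.
  - by apply: near_derive_ln; exact: powR_gt0.
  - by apply: cvgV; [rewrite gt_eqF// powR_gt0|exact: cvg_id].
apply: cvgM; first exact: cvgM.
apply: cvgV; first by rewrite gt_eqF// mulr_gt0// addr_gt0// powR_gt0.
by apply: cvgM => //; exact: cvg_cst.
Qed.

End ProcrustesSymbol.

(** For a = 1 the logarithms cancel and the symbol is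
    2 (x^2 + y^2) / (x + y)^2. *)
Lemma inverse_metric_symbol1_bounds (R : realType) (x y : R) : 0 < x -> 0 < y ->
  1 <= inverse_metric_symbol 1 x y <= 2.
Proof.
move=> x0 y0; have xy0 : 0 < x + y by exact: addr_gt0.
have symbolE : procrustes_symbol 1 x y = 2 * (x ^+ 2 + y ^+ 2) / (x + y).
  have [->|xy] := eqVneq x y.
    by rewrite procrustes_symbol_diag//; field; rewrite gt_eqF// addr_gt0.
  rewrite /procrustes_symbol mulr1 !powR_mulrn ?(ltW x0) ?(ltW y0)// /dd.
  have ln_xy : ln x != ln y by apply: contra_neq xy => /ln_inj; apply; rewrite posrE.
  have sqr_xy : x ^+ 2 != y ^+ 2.
    by rewrite eqf_sqr (negPf xy)/= -addr_eq0 gt_eqF.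
  rewrite (negPf ln_xy) (negPf sqr_xy) !lnK ?posrE// !lnXn//.
  have u0 : ln y - ln x != 0 by rewrite subr_eq0 eq_sym.
  by field; rewrite u0 subr_eq0 (eq_sym (y ^+ 2)) sqr_xy gt_eqF.
rewrite /inverse_metric_symbol symbolE mulr1 !powR_mulrn ?(ltW x0) ?(ltW y0)//.
have -> : (2 * (x ^+ 2 + y ^+ 2) / (x + y)) ^+ 2 / (2 * (x ^+ 2 + y ^+ 2)) =
    2 * (x ^+ 2 + y ^+ 2) / (x + y) ^+ 2.
  by field; rewrite !gt_eqF// addr_gt0// exprn_gt0.
rewrite ler_pdivlMr ?exprn_gt0// ler_pdivrMr ?exprn_gt0//; apply/andP; split.
  by have := sqr_ge0 (x - y); lra.
by have := mulr_gt0 x0 y0; lra.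
Qed.

Section ProcrustesMetric.
Variables (R : realType) (n : nat) (a : R).
Local Notation S := (Sym R n).
Variables (P : S) (Q : 'M[R]_n) (l : 'rV[R]_n).
Hypotheses (PQ : is_spectral P Q l) (l_gt0 : forall i, 0 < l 0 i).
Implicit Types (G H X Y : S).

Let QQ : Q *m Q^T = 1%:M := PQ.1.
Let pow : 'rV[R]_n := map_mx (fun x => x `^ (2 * a)) l.

Let pow_gt0 i : 0 < pow 0 i.
Proof. by rewrite mxE powR_gt0. Qed.

Let sympowE : sympow P (2 * a) = specS Q pow.
Proof. exact: (spectral_calculusE _ PQ). Qed.

(** All three operators are multipliers in the eigenbasis of P, so their symbols
    multiply. *)
Lemma procrustes_operatorE H :
  'd (@symexp R n) (symlog P)
    ('d (@symlog R n) (sympow P (2 * a)) (anticomm H (sympow P (2 * a)))) =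
  schurS Q (kernelS (procrustes_symbolC a) l) H.
Proof.
have psiC x y : x `^ (2 * a) + y `^ (2 * a) = y `^ (2 * a) + x `^ (2 * a) :> R.
  exact: addrC.
rewrite sympowE (anticomm_schur psiC (l := l) _ QQ) => [|i j]; last by rewrite !mxE.
have logP : symlog P = specS Q (map_mx (@ln R) l) by exact: spectral_calculusE.
rewrite (diff_spectral_calculus (phi' := fun x => x^-1) (is_spectral_specS pow QQ)); first last.
- by move=> i; apply: cvgV; [rewrite gt_eqF|exact: cvg_id].
- by move=> i; exact: near_derive_ln.
rewrite logP (diff_spectral_calculus (phi' := expR)
  (is_spectral_specS (map_mx (@ln R) l) QQ)); first last.
- by move=> i; exact: continuous_expR.
- by move=> i; exact: near_derive_expR.
apply: val_inj; rewrite /= !schur_comp//; congr schur.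
by apply/matrixP => i j; rewrite !mxE -mulrA.
Qed.

Fact inv_symbolC (phi : R -> R -> R) : (forall x y, phi x y = phi y x) ->
  forall x y, (phi x y)^-1 = (phi y x)^-1.
Proof. by move=> phiC x y; rewrite phiC. Qed.

Lemma schurS_kernelK (phi : R -> R -> R) (phiC : forall x y, phi x y = phi y x) X :
  (forall x y, 0 < x -> 0 < y -> 0 < phi x y) ->
  schurS Q (kernelS phiC l) (schurS Q (kernelS (inv_symbolC phiC) l) X) = X /\
  schurS Q (kernelS (inv_symbolC phiC) l) (schurS Q (kernelS phiC l) X) = X.
Proof.
move=> phi_gt0; have QtQ := QQ; split.
  rewrite (schurS_comp (K'' := kernelS (fun _ _ => erefl 1) l))// => [|i j].
    by rewrite schurS_1// => i j; rewrite mxE.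
  by rewrite !mxE mulfV// gt_eqF// phi_gt0.
rewrite (schurS_comp (K'' := kernelS (fun _ _ => erefl 1) l))// => [|i j].
  by rewrite schurS_1// => i j; rewrite mxE.
by rewrite !mxE mulVf// gt_eqF// phi_gt0.
Qed.

Lemma procrustes_L_schur Y :
  procrustes_L a P Y = schurS Q (kernelS (inv_symbolC (procrustes_symbolC a)) l) Y.
Proof.
pose V := [set H : S | 'd (@symexp R n) (symlog P)
    ('d (@symlog R n) (sympow P (2 * a)) (anticomm H (sympow P (2 * a)))) = Y].
have inverse X := schurS_kernelK (procrustes_symbolC a) X (@procrustes_symbol_gt0 _ a).
have /getPex : V !=set0.
  exists (schurS Q (kernelS (inv_symbolC (procrustes_symbolC a)) l) Y).
  by rewrite /V/= procrustes_operatorE (inverse Y).1.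
by rewrite {1}/V/= procrustes_operatorE => {2}<-; rewrite (inverse _).2.
Qed.

Lemma procrustes_metric_schur X Y : procrustes_metric a P X Y =
  frob X (schurS Q (kernelS (inv_symbolC (inverse_metric_symbolC a)) l) Y).
Proof.
rewrite /procrustes_metric !procrustes_L_schur (frob_schur _ _ _ QQ) sympowE.
set K := kernelS _ l; set x := rotated Q X; set y := rotated Q Y.
rewrite (mxtrace_rotated _ _ QQ) mxtrace_mul.
pose u i j := val K i j ^+ 2 * x i j * y i j.
have -> : Q^T *m (val (schurS Q K X) *m spec Q pow) *m Q =
    rotated Q (schurS Q K X) *m diag_mx pow.
  by rewrite -[LHS]mulmxA -(mulmxA (val _)) mul_spec// /rotated !mulmxA.
have u_sym i j : u i j = u j i.
  by rewrite /u sym_entry /x rotated_sym /y (rotated_sym Q Y).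
have -> : \sum_i \sum_j (rotated Q (schurS Q K X) *m diag_mx pow) i j *
    (Q^T *m val (schurS Q K Y) *m Q) j i = \sum_i \sum_j u i j * pow 0 j.
  apply: eq_bigr => i _; apply: eq_bigr => j _.
  rewrite -/(rotated Q (schurS Q K Y)) (rotated_sym _ _ j) mul_mx_diag [X in X * _]mxE.
  rewrite !rotated_schur// /u -/x -/y; ring.
(* Averaging over the transposition of (i, j) symmetrizes the weight pow_j. *)
have -> : 4 * (\sum_i \sum_j u i j * pow 0 j) =
    2 * (\sum_i \sum_j u i j * (pow 0 i + pow 0 j)).
  have swap : \sum_i \sum_j u i j * pow 0 i = \sum_i \sum_j u i j * pow 0 j.
    rewrite exchange_big/=; apply: eq_bigr => j _; apply: eq_bigr => i _.
    by rewrite u_sym.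
  rewrite [X in _ = _ * X](_ : _ = \sum_i \sum_j u i j * pow 0 i + \sum_i \sum_j u i j * pow 0 j).
    by rewrite swap; ring.
  rewrite -big_split/=; apply: eq_bigr => i _; rewrite -big_split/=.
  by apply: eq_bigr => j _; rewrite mulrDr.
rewrite mulr_sumr; apply: eq_bigr => i _; rewrite mulr_sumr; apply: eq_bigr => j _.
have psi0 := procrustes_symbol_gt0 a (l_gt0 i) (l_gt0 j).
have powi := powR_gt0 (2 * a) (l_gt0 i); have powj := powR_gt0 (2 * a) (l_gt0 j).
rewrite /u; move: (x i j) (y i j) => xij yij.
rewrite !mxE /inverse_metric_symbol.
by field; rewrite !gt_eqF// addr_gt0.
Qed.

Lemma riem_grad_schur (f : S -> R) G : (forall Y, frob G Y = 'd f P Y) ->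
  riem_grad (@procrustes_metric R n a) f P =
  schurS Q (kernelS (inverse_metric_symbolC a) l) G.
Proof.
move=> G_grad.
have inverse X := schurS_kernelK (inverse_metric_symbolC a) X (@inverse_metric_symbol_gt0 _ a).
pose V := [set H : S | forall Y : S, procrustes_metric a P H Y = 'd f P Y].
have frob_schurC H Y : frob H (schurS Q (kernelS (inv_symbolC (inverse_metric_symbolC a)) l) Y) =
    frob (schurS Q (kernelS (inv_symbolC (inverse_metric_symbolC a)) l) H) Y.
  rewrite [RHS]frobC !(frob_schur _ _ _ QQ).
  by apply: eq_bigr => i _; apply: eq_bigr => j _; congr (_ * _); rewrite mulrC.
have /getPex : V !=set0.
  exists (schurS Q (kernelS (inverse_metric_symbolC a) l) G) => Y.
  by rewrite procrustes_metric_schur frob_schurC (inverse G).2 G_grad.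
move=> getE; rewrite -[LHS]/(get V) -[get V](inverse _).1; congr schurS.
apply: frob_inj => Y; rewrite G_grad -(getE Y) procrustes_metric_schur.
exact/esym/frob_schurC.
Qed.

End ProcrustesMetric.

(** * Second derivatives on normed spaces *)

Section SecondDerivative.
Variables (R : realType) (V : normedModType R).
Implicit Types (f : V -> R) (X Y Z W : V).

Lemma is_derive_line f X Y (t : R) : differentiable f (X + t *: Y) ->
  is_derive t (1 : R) (fun s : R => f (X + s *: Y)) ('d f (X + t *: Y) Y).
Proof.
move=> f_diff; set g := fun s : R => f (X + s *: Y).
have quotientE : (fun h : R => h^-1 *: ((g \o shift t) (h *: (1 : R)) - g t)) =
    (fun h : R => h^-1 *: ((f \o shift (X + t *: Y)) (h *: Y) - f (X + t *: Y))).
  apply/funext => h /=; rewrite /g; congr (_ *: (f _ - _)).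
  by rewrite [h *: (1 : R)]mulr1 scalerDl addrCA.
apply: DeriveDef.
  by rewrite /derivable quotientE; exact: diff_derivable.
by rewrite -deriveE// /derive quotientE.
Qed.

(** The mean value theorem is applied in direction Y to the increment of f along
    h Z, and then in direction Z to the derivative of f along Y. *)
Lemma second_difference f P Y Z (h r : R) : 0 < h < r ->
    (forall s t : R, `|s| < r -> `|t| < r -> differentiable f (P + s *: Y + t *: Z)) ->
    (forall s t : R, `|s| < r -> `|t| < r ->
      differentiable (fun X => 'd f X Y : R) (P + s *: Y + t *: Z)) ->
  exists s t : R, [/\ `|s| < r, `|t| < r &
    f (P + h *: Y + h *: Z) - f (P + h *: Y) - (f (P + h *: Z) - f P) =
    'd (fun X => 'd f X Y : R) (P + s *: Y + t *: Z) Z * h ^+ 2].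
Proof.
move=> /andP[h0 hr] f_diff df_diff.
have small s : 0 <= s <= h -> `|s| < r.
  by move=> /andP[s0 sh]; rewrite ger0_norm// (le_lt_trans sh).
have r0 : `|0 : R| < r by rewrite normr0 (lt_trans h0).
have hr' : `|h| < r by apply: small; rewrite lexx ltW.
pose F (s : R) := f (P + h *: Z + s *: Y) - f (P + s *: Y).
have F_derive s : 0 <= s <= h ->
    is_derive s (1 : R) F ('d f (P + s *: Y + h *: Z) Y - 'd f (P + s *: Y) Y).
  move=> /small sr; apply: is_deriveB.
    by rewrite addrAC; apply: is_derive_line; rewrite addrAC; exact: f_diff.
  by apply: is_derive_line; have := f_diff s 0 sr r0; rewrite scale0r addr0.
have [||s s_in F_eq] := @MVT _ F
  (fun s => 'd f (P + s *: Y + h *: Z) Y - 'd f (P + s *: Y) Y) 0 h h0.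
- by move=> s; rewrite in_itv/= => /andP[s0 sh]; apply: F_derive; rewrite !ltW.
- by apply: derivable_within_continuous => s; rewrite in_itv/= => /F_derive[].
have {s_in} s_r : `|s| < r.
  by apply: small; move: s_in; rewrite in_itv/= => /andP[/ltW-> /ltW->].
pose G (t : R) := 'd f (P + s *: Y + t *: Z) Y.
have G_derive t : 0 <= t <= h ->
    is_derive t (1 : R) G ('d (fun X => 'd f X Y : R) (P + s *: Y + t *: Z) Z).
  by move=> /small tr; apply: (is_derive_line (f := fun X => 'd f X Y)); exact: df_diff.
have [||t t_in G_eq] := @MVT _ G
  (fun t => 'd (fun X => 'd f X Y : R) (P + s *: Y + t *: Z) Z) 0 h h0.
- by move=> t; rewrite in_itv/= => /andP[t0 th]; apply: G_derive; rewrite !ltW.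
- by apply: derivable_within_continuous => t; rewrite in_itv/= => /G_derive[].
exists s, t; split=> //.
  by apply: small; move: t_in; rewrite in_itv/= => /andP[/ltW-> /ltW->].
have -> : f (P + h *: Y + h *: Z) - f (P + h *: Y) - (f (P + h *: Z) - f P) = F h - F 0.
  by rewrite /F !scale0r !addr0 (addrAC P (h *: Z)).
rewrite F_eq subr0 expr2 mulrA; congr (_ * _).
by move: G_eq; rewrite /G scale0r addr0 subr0.
Qed.

(** Both mixed second derivatives are limits of the symmetric second
    difference. *)
Lemma second_derivative_sym f P Y Z :
    (\forall X \near P, differentiable f X) ->
    (forall W, \forall X \near P, differentiable (fun X' => 'd f X' W : R) X) ->
    (forall W W', {for P, continuous (fun X => 'd (fun X' => 'd f X' W : R) X W' : R)}) ->
  'd (fun X => 'd f X Y : R) P Z = 'd (fun X => 'd f X Z : R) P Y.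
Proof.
move=> f_diff df_diff ddf_cont; apply/eqP; rewrite -subr_eq0 -normr_le0.
apply/ler_addgt0Pr => e e0; rewrite add0r.
have e2 : 0 < e / 2 by rewrite divr_gt0.
have near_YZ W W' := (cvgrPdist_lt _ _).1 (ddf_cont W W') _ e2.
have : \forall X \near P, [/\ differentiable f X,
    differentiable (fun X' => 'd f X' Y : R) X,
    differentiable (fun X' => 'd f X' Z : R) X,
    `|'d (fun X => 'd f X Y : R) P Z - 'd (fun X => 'd f X Y : R) X Z| < e / 2 &
    `|'d (fun X => 'd f X Z : R) P Y - 'd (fun X => 'd f X Z : R) X Y| < e / 2].
  near=> X; split; near: X.
  - exact: f_diff.
  - exact: df_diff.
  - exact: df_diff.
  - exact: near_YZ.
  - exact: near_YZ.
move=> /nbhs_ballP[d /= d0 near_P].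
pose r := d / (`|Y| + `|Z| + 1).
have N0 : 0 < `|Y| + `|Z| + 1 by rewrite ltr_wpDl// addr_ge0.
have r0 : 0 < r by rewrite divr_gt0.
have in_ball s t : `|s| < r -> `|t| < r -> ball P d (P + s *: Y + t *: Z).
  move=> sr tr; rewrite -ball_normE /= -addrA opprD addrA subrr sub0r normrN.
  rewrite (le_lt_trans (ler_normD _ _))// !normrZ.
  have -> : d = r * (`|Y| + `|Z| + 1) by rewrite divfK// gt_eqF.
  rewrite mulrDr mulr1 mulrDr ltr_pwDr// lerD//.
    by rewrite ler_wpM2r ?(ltW sr).
  by rewrite ler_wpM2r ?(ltW tr).
have h_in : 0 < r / 2 < r by rewrite divr_gt0//= ltr_pdivrMr// ltr_pMr// ltr1n.
have swap s t : P + s *: Z + t *: Y = P + t *: Y + s *: Z by rewrite addrAC.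
have [u [v [ur vr YZ]]] := second_difference (Y := Y) (Z := Z) h_in
  (fun s t sr tr => let: And5 d _ _ _ _ := near_P _ (in_ball s t sr tr) in d)
  (fun s t sr tr => let: And5 _ d _ _ _ := near_P _ (in_ball s t sr tr) in d).
have [u' [v' [ur' vr' ZY]]] : exists s t : R, [/\ `|s| < r, `|t| < r &
    f (P + (r / 2) *: Z + (r / 2) *: Y) - f (P + (r / 2) *: Z) -
    (f (P + (r / 2) *: Y) - f P) =
    'd (fun X => 'd f X Z : R) (P + s *: Z + t *: Y) Y * (r / 2) ^+ 2].
  apply: second_difference h_in _ _ => s' t' sr' tr'; rewrite swap.
    by have [] := near_P _ (in_ball t' s' tr' sr').
  by have [] := near_P _ (in_ball t' s' tr' sr').
have [_ _ _ nearYZ _] := near_P _ (in_ball u v ur vr).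
have [_ _ _ _ nearZY] := near_P _ (in_ball v' u' vr' ur').
have ddf_eq : 'd (fun X => 'd f X Y : R) (P + u *: Y + v *: Z) Z =
    'd (fun X => 'd f X Z : R) (P + v' *: Y + u' *: Z) Y.
  have h2 : (r / 2) ^+ 2 != 0 by rewrite expf_neq0// gt_eqF// divr_gt0.
  apply: (mulIf h2); rewrite -YZ -[in RHS]swap -ZY swap; ring.
move: nearYZ nearZY; rewrite ddf_eq !ltr_norml ler_norml; lra.
Unshelve. all: by end_near. Qed.

Lemma diff_local_min f P : (\forall X \near P, differentiable f X) ->
  (\forall X \near P, f P <= f X) -> forall Y, 'd f P Y = 0.
Proof.
move=> f_diff f_min Y.
have : \forall X \near P, differentiable f X /\ f P <= f X by exact: filterI.
move=> /nbhs_ballP[d /= d0 near_P].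
pose r := d / (`|Y| + 1).
have N0 : 0 < `|Y| + 1 by rewrite ltr_wpDl.
have r0 : 0 < r by rewrite divr_gt0.
have in_ball s : `|s| < r -> ball P d (P + s *: Y).
  move=> sr; rewrite -ball_normE /= opprD addrA subrr sub0r normrN normrZ.
  have -> : d = r * (`|Y| + 1) by rewrite divfK// gt_eqF.
  by rewrite (le_lt_trans (y := `|s| * (`|Y| + 1)))// ?ltr_pM2r// ler_wpM2l// lerDl.
have itvE s : s \in `](- r), r[ -> `|s| < r by rewrite in_itv/= ltr_norml.
have line_derive s : `|s| < r ->
    is_derive s (1 : R) (fun t : R => f (P + t *: Y)) ('d f (P + s *: Y) Y).
  by move=> sr; apply: is_derive_line; have [] := near_P _ (in_ball s sr).
have := @derive1_at_min R (fun t : R => f (P + t *: Y)) (- r) r 0.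
have -> : - r <= r by rewrite ge0_cp// ltW.
move=> /(_ isT) min0.
have [||| _ d_eq0] := min0.
- by move=> s /itvE/line_derive[].
- by rewrite in_itv/= oppr_lt0 r0.
- by move=> s /itvE sr; rewrite scale0r addr0; have [] := near_P _ (in_ball s sr).
have [_ d_eq] := line_derive 0 (eq_ind_r (fun z => z < r) r0 (normr0 R)).
by move: d_eq; rewrite d_eq0 scale0r addr0.
Qed.

End SecondDerivative.

(** * Gradients and Hessians on Sym(n) *)

Section Gradients.
Variables (R : realType) (n : nat).
Local Notation S := (Sym R n).
Implicit Types (f : S -> R) (P X Y Z : S) (Q : 'M[R]_n) (l : 'rV[R]_n).

(** The eigenvalues of a nearby matrix are close to positive eigenvalues. *)
Lemma near_SPD P : SPD P -> \forall X \near P, SPD X.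
Proof.
have [Q [l PQ]] := spectral_exists P; have [QQ PE] := PQ.
move=> /(SPD_spectral PQ) l_gt0.
have : \forall rho \near 0^'+, forall i, rho <= l 0 i.
  by apply: filter_forall => i; exact: nbhs_right_le.
move=> near_rho; have : \forall rho \near 0^'+, 0 < rho :> R by exact: nbhs_right_gt.
move=> /(filterI near_rho)/filter_ex[rho [rho_le rho0]].
pose N : R := n%:R + 1; pose K : R := n%:R ^+ 2 + 1.
have N1 : 1 <= N by rewrite lerDr.
have N0 : 0 < N by exact: lt_le_trans N1.
have K0 : 0 < K by rewrite ltr_wpDl// sqr_ge0.
have small : n%:R * N^-1 ^+ 2 < 1.
  rewrite expr2 mulrA (le_lt_trans (y := n%:R / N))//.
    by apply: ler_piMr; [rewrite divr_ge0// ltW|rewrite invf_le1].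
  by rewrite ltr_pdivrMr// mul1r ltrDl.
apply/nbhs_ballP; exists (N^-1 * rho / K) => /=.
  by rewrite divr_gt0// mulr_gt0// invr_gt0.
move=> X; rewrite -ball_normE /= distrC => XP.
have [U [m XU]] := spectral_exists X; have [UU XE] := XU.
apply/(SPD_spectral XU) => i.
have close : n%:R ^+ 2 * `|spec U m - spec Q l| <= N^-1 * rho.
  rewrite -[spec U m]XE -[spec Q l]PE -[val X - val P]/(val (X - P)) -sym_normE.
  rewrite (le_trans (ler_wpM2l (sqr_ge0 _) (ltW XP)))// mulrCA ger_pMr ?mulr_gt0 ?invr_gt0//.
  by rewrite ler_pdivrMr// mul1r lerDl.
have [k] := near_eigenvalue i UU QQ rho0 close small.
by rewrite ltr_norml => /andP[lk _]; have := rho_le k; lra.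
Qed.

(** Symmetrized matrix units: the family dual to the entries under the Frobenius
    product. *)
Definition symunit (i j : 'I_n) : 'M[R]_n := 2^-1 *: (delta_mx i j + delta_mx j i).

Fact symunit_sym i j : symunit i j \in @issym R n.
Proof. by rewrite issymE /symunit linearZ/= linearD/= !trmx_delta addrC. Qed.

Definition symunitS i j : S := MkSym (symunit_sym i j).

Lemma frob_symunit i j Y : frob (symunitS i j) Y = val Y i j.
Proof.
rewrite /frob sym_trmx /= /symunit -scalemxAl mxtraceZ mulmxDl mxtraceD.
have trace_delta k h : \tr (delta_mx k h *m val Y) = val Y h k.
  rewrite mxtrace_mul (bigD1 k)//= (bigD1 h)//= mxE !eqxx mul1r.
  rewrite [X in _ + X + _]big1 => [|y yh]; last by rewrite mxE (negPf yh) andbF mul0r.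
  rewrite big1 ?addr0// => x xk.
  by apply: big1 => y _; rewrite mxE (negPf xk) mul0r.
by rewrite !trace_delta sym_entry; field.
Qed.

Lemma frob_riesz (L : {linear S -> R^o}) Y :
  frob (\sum_i \sum_j L (symunitS i j) *: symunitS i j) Y = L Y.
Proof.
have decomposition : Y = \sum_i \sum_j val Y i j *: symunitS i j.
  apply: frob_inj => Z; rewrite [RHS]frobC linear_sum frobE; apply: eq_bigr => i _.
  rewrite linear_sum; apply: eq_bigr => j _.
  by rewrite linearZ/= frobC frob_symunit.
rewrite frobC linear_sum [in RHS]decomposition linear_sum; apply: eq_bigr => i _.
rewrite !linear_sum; apply: eq_bigr => j _.
by rewrite !linearZ/= [frob Y _]frobC frob_symunit; exact: mulrC.
Qed.

Lemma euclid_gradE f X :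
  euclid_grad f X = \sum_i \sum_j ('d f X (symunitS i j) : R) *: symunitS i j.
Proof.
pose V := [set G : S | forall Y : S, frob G Y = 'd f X Y].
have /getPex getE : V !=set0.
  exists (\sum_i \sum_j ('d f X (symunitS i j) : R) *: symunitS i j) => Y.
  exact: (frob_riesz ('d f X : {linear S -> R^o})).
apply: frob_inj => Y; rewrite (getE Y).
by rewrite (frob_riesz ('d f X : {linear S -> R^o})).
Qed.

Lemma frob_euclid_grad f X Y : frob (euclid_grad f X) Y = 'd f X Y.
Proof. by rewrite euclid_gradE (frob_riesz ('d f X : {linear S -> R^o})). Qed.

Lemma differentiable_euclid_grad f P :
    (forall Y, differentiable (fun X => 'd f X Y : R) P) ->
  differentiable (euclid_grad f) P.
Proof.
move=> df_diff.
have -> : euclid_grad f = \sum_i \sum_j (fun X => ('d f X (symunitS i j) : R) *: symunitS i j).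
  apply/funext => X; rewrite euclid_gradE fct_sumE; apply: eq_bigr => i _.
  by rewrite fct_sumE.
apply: differentiable_sum => i; apply: differentiable_sum => j.
exact: differentiableZl.
Qed.

Lemma frob_continuous Y : continuous (frob Y : S -> R^o).
Proof.
apply: bounded_linear_continuous; apply/linear_boundedP; near=> r => X.
apply: (@le_trans _ _ (n%:R ^+ 2 * `|val Y| * `|X|)).
  rewrite -[X in `|X|]/(frob Y X) frobE (le_trans (ler_norm_sum _ _ _))// expr2 -!mulrA mulr_natl.
  rewrite -[X in _ *+ X]card_ord -sumr_const; apply: ler_sum => i _.
  rewrite (le_trans (ler_norm_sum _ _ _))// mulr_natl.
  rewrite -[X in _ *+ X]card_ord -sumr_const; apply: ler_sum => j _.
  by rewrite normrM ler_pM// ?ler_mx_norm.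
by rewrite ler_wpM2r//; near: r; exact: nbhs_pinfty_ge.
Unshelve. all: by end_near. Qed.

Lemma frob_euclid_hess f P Y Z :
    (forall Y, differentiable (fun X => 'd f X Y : R) P) ->
  frob Y (euclid_hess f P Z) = 'd (fun X => 'd f X Y : R) P Z.
Proof.
move=> /differentiable_euclid_grad grad_diff.
have -> : (fun X => 'd f X Y : R) = (frob Y : S -> R^o) \o euclid_grad f.
  by apply/funext => X; rewrite /= frobC frob_euclid_grad.
rewrite diff_comp//; last exact/linear_differentiable/frob_continuous.
by rewrite /= diff_lin//; exact: frob_continuous.
Qed.

(** The Riemannian gradient at X is G_X^-1 applied to the Euclidean gradient.
    The latter vanishes at P, so the variation of G_X^-1, which tends to 0, is
    multiplied by a quantity of first order in X - P. *)
Lemma diff_riem_grad (a : R) f P Q l : SPD P -> is_spectral P Q l ->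
    (forall Y, differentiable (fun X => 'd f X Y : R) P) ->
    (forall Y, 'd f P Y = 0 :> R) ->
  differentiable (riem_grad (@procrustes_metric R n a) f) P /\
  forall Y, 'd (riem_grad (@procrustes_metric R n a) f) P Y =
    schurS Q (kernelS (inverse_metric_symbolC a) l) (euclid_hess f P Y).
Proof.
move=> P_SPD PQ df_diff df0; have [QQ PE] := PQ.
have l_gt0 := (SPD_spectral PQ).1 P_SPD.
set T := schurS Q (kernelS (inverse_metric_symbolC a) l).
have grad_diff := differentiable_euclid_grad df_diff.
have grad0 : euclid_grad f P = 0.
  by apply: frob_inj => Y; rewrite frob_euclid_grad df0 frobC linear0.
have rgrad X U m : SPD X -> is_spectral X U m ->
    riem_grad (@procrustes_metric R n a) f X =
    schurS U (kernelS (inverse_metric_symbolC a) m) (euclid_grad f X).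
  move=> X_SPD XU; apply: riem_grad_schur => //; first exact/(SPD_spectral XU).
  exact: frob_euclid_grad.
have T_bound E : `|T E| <= n%:R ^+ 2 * (`|kernel (inverse_metric_symbol a) l l| * n%:R ^+ 2) * `|E|.
  by rewrite !sym_normE (le_trans (schur_norm _ _ QQ QQ))// !mulrA.
set M := _ * (_ * _) in T_bound.
have M0 : 0 <= M by rewrite /M !mulr_ge0.
have [k k0 dgrad_bound] := linear_lipschitz (diff_continuous grad_diff).
have /diff_locallyP[_ /eqaddoP grad_expansion] := grad_diff.
pose dF := [the {linear S -> S} of T \o 'd (euclid_grad f) P].
suff : differentiable (riem_grad (@procrustes_metric R n a) f) P /\
  'd (riem_grad (@procrustes_metric R n a) f) P = dF :> (S -> S).
  by move=> [? ->].
apply: (@diff_of_expansion R S S _ _ _ (M * k)) => [h|e e0].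
  by rewrite (le_trans (T_bound _))// -(mulrA M) ler_wpM2l.
pose e1 := e / (M + k + 2).
have N0 : 0 < M + k + 2 by rewrite addr_gt0// ltr_wpDl.
have e10 : 0 < e1 by rewrite divr_gt0.
pose e2 := Num.min 1 e1.
have e20 : 0 < e2 by rewrite lt_min ltr01.
have [i j|delta delta0 close] := @schur_continuous R n (inverse_metric_symbol a) Q l Q l e2 QQ QQ e20.
  exact: inverse_metric_symbol_continuous.
have /nbhs_ballP[d1 /= d10 SPD_ball] := near_SPD P_SPD.
have /nbhs_ballP[d2 /= d20 grad_ball] := grad_expansion e2 e20.
apply/nbhs_ballP; exists (Num.min d1 (Num.min d2 delta)) => /=; first by rewrite !lt_min d10 d20.
move=> h; rewrite -ball_normE /= sub0r normrN !lt_min => /and3P[hd1 hd2 hdelta].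
have h_SPD : SPD (h + P).
  by apply: SPD_ball; rewrite -ball_normE /= opprD addrCA subrr addr0 normrN.
have [U [m XU]] := spectral_exists (h + P).
rewrite (rgrad _ _ _ h_SPD XU) (rgrad _ _ _ P_SPD PQ) grad0 linear0 subr0 /=.
set G := euclid_grad f (h + P); set D := 'd (euclid_grad f) P h.
have GD : `|G - D| <= e2 * `|h|.
  have := grad_ball h; rewrite -ball_normE /= sub0r normrN => /(_ hd2).
  by rewrite !fctE /= grad0 add0r.
have D_le : `|D| <= k * `|h| by exact: dgrad_bound.
have G_le : `|G| <= (k + 1) * `|h|.
  rewrite -(subrK D G) (le_trans (ler_normD _ _))// mulrDl addrC lerD//.
  by rewrite (le_trans GD)// ler_wpM2r// ge_min lexx.
have TG : `|schurS U (kernelS (inverse_metric_symbolC a) m) G - T G| <= e2 * `|G|.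
  have [UU XE] := XU; have hE : val h = spec U m - spec Q l by rewrite /spec -XE -PE /= addrK.
  rewrite !sym_normE; by apply: close => //; rewrite -hE.
have -> : schurS U (kernelS (inverse_metric_symbolC a) m) G - T D =
    (schurS U (kernelS (inverse_metric_symbolC a) m) G - T G) + T (G - D).
  by rewrite /T linearB addrA subrK.
rewrite (le_trans (ler_normD _ _))// (le_trans (lerD TG (T_bound _)))//.
have e2_le : e2 * (M + k + 2) <= e by rewrite -ler_pdivlMr// ge_min lexx orbT.
have h0 : 0 <= `|h| by [].
rewrite (le_trans (lerD (ler_wpM2l (ltW e20) G_le) (ler_wpM2l M0 GD)))//.
rewrite (le_trans _ (ler_wpM2r h0 e2_le))//.
by move: (M) e20 h0 => M' e20 h0; have := mulr_ge0 (ltW e20) h0; lra.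
Qed.

End Gradients.

(** * Matrices of the Hessians at a critical point *)

Section Hessians.
Variables (R : realType) (n : nat).
Local Notation S := (Sym R n).

(** At a zero of Z, torsion-freeness against a constant field determines the
    covariant derivative: the other terms vanish with Z. *)
Lemma covariant_derivative_at_zero (U : set S) g nabla (P v : S) (Z : S -> S) :
    is_levi_civita U g nabla -> U P -> differentiable Z P -> Z P = 0 ->
  nabla P v Z = 'd Z P v.
Proof.
move=> LC UP Z_diff Z0.
have cst_diff : differentiable (cst v : S -> S) P by exact: differentiable_cst.
have nabla0 : nabla P 0 (cst v) = 0.
  have := connection_linear LC 1 0 0 UP cst_diff.
  rewrite !scale1r addr0 => /eqP; rewrite -subr_eq0 opprD addrA subrr sub0r oppr_eq0.
  by move=> /eqP.
have d_cst : 'd (cst v : S -> S) P (Z P) = 0 by rewrite Z0 linear0.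
have nablaZ0 : nabla P (Z P) (cst v) = 0 by rewrite Z0.
have cancel (x y z t : S) : x - y = z - t -> y = 0 -> t = 0 -> x = z.
  by move=> + y0 t0; rewrite y0 t0 !subr0.
exact: cancel (torsion_free LC UP cst_diff Z_diff) nablaZ0 d_cst.
Qed.

Variable Q : 'M[R]_n.
Hypothesis QQ : Q *m Q^T = 1%:M.

Let QtQ : Q^T *m Q = 1%:M := mulmx1C QQ.

Lemma rotated_eigenbasis i j a b : rotated Q (eigenbasis Q i j) a b =
  (if i == j then 1 else (Num.sqrt 2)^-1) *
  (((a == i) && (b == j)) || ((a == j) && (b == i)))%:R.
Proof.
have cancel X : Q^T *m (Q *m X *m Q^T) *m Q = X.
  by rewrite !mulmxA QtQ mul1mx -mulmxA QtQ mulmx1.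
rewrite /rotated /= /eigenbasis_mx; case: eqVneq => [<-|ij].
  by rewrite cancel mxE orbb mul1r.
rewrite -scalemxAr -scalemxAl cancel !mxE; congr (_ * _).
case: eqVneq => [->|] /=; last by rewrite add0r.
by rewrite (negPf ij) addr0 orbF.
Qed.

Lemma frob_eigenbasis_schur K (Z : S) i j :
  frob (eigenbasis Q i j) (schurS Q K Z) = val K i j * frob (eigenbasis Q i j) Z.
Proof.
rewrite frob_schur// (frob_rotated _ _ QQ) mulr_sumr; apply: eq_bigr => a _.
rewrite mulr_sumr; apply: eq_bigr => b _; rewrite !rotated_eigenbasis.
case: orP => [[] /andP[/eqP-> /eqP->]|_]; first by [].
  by rewrite (sym_entry K).
by rewrite !mulr0 !mul0r !mulr0.
Qed.

Local Notation basis k := (eigenbasis Q (enum_val k).1 (enum_val k).2).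

Lemma operator_mx_schur K (T T' : S -> S) : (forall Z, T' Z = schurS Q K (T Z)) ->
  operator_mx Q T' =
  diag_mx (\row_k val K (enum_val k).1 (enum_val k).2) *m operator_mx Q T.
Proof.
move=> T'E; apply/matrixP => k h; rewrite mul_diag_mx !mxE.
by rewrite T'E frob_eigenbasis_schur.
Qed.

(** In the basis of the columns of Q, the entry (i, j) with i <= j is supported
    by the basis element of index (i, j) alone. *)
Lemma eigenbasis_free (v : 'rV[R]_#|basis_index n|) :
  \sum_k v 0 k *: basis k = 0 -> v = 0.
Proof.
move=> v0; apply/rowP => k; rewrite [RHS]mxE.
set i := (enum_val k).1; set j := (enum_val k).2.
have : rotated Q (\sum_h v 0 h *: basis h) i j = 0.
  by rewrite v0 /rotated mulmx0 mul0mx mxE.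
have -> : rotated Q (\sum_h v 0 h *: basis h) i j =
    \sum_h v 0 h * rotated Q (basis h) i j.
  rewrite /rotated raddf_sum mulmx_sumr mulmx_suml summxE; apply: eq_bigr => h _.
  by rewrite [val _]/= -scalemxAr -scalemxAl mxE.
rewrite (bigD1 k)//= big1 ?addr0 => [|h hk]; rewrite rotated_eigenbasis.
  rewrite !eqxx mulr1 => /eqP; rewrite mulf_eq0 => /orP[/eqP//|].
  by case: ifP => _; rewrite ?oner_eq0// invr_eq0 gt_eqF// sqrtr_gt0.
have ordered (l : 'I_#|basis_index n|) : ((enum_val l).1 <= (enum_val l).2)%N.
  by have := enum_valP l; rewrite inE.
case: orP => [[] /andP[/eqP e1 /eqP e2]|_]; last by rewrite !mulr0.
  case/negP: hk; apply/eqP/enum_val_inj/esym.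
  by rewrite [LHS]surjective_pairing [RHS]surjective_pairing -e1 -e2.
case/negP: hk; apply/eqP/enum_val_inj/esym.
have := ordered h; rewrite -e1 -e2 => ji; have ij := ordered k.
have ijE : i = j by apply/val_inj/eqP; rewrite eqn_leq ij ji.
by rewrite [LHS]surjective_pairing [RHS]surjective_pairing -e1 -e2 -/i -/j ijE.
Qed.

Variables (f : S -> R) (P : S).
Hypothesis f_C2 : twice_continuously_differentiable_on SPD f.
Hypothesis P_min : local_minimizer_on SPD f P.
Hypothesis P_nondeg : nondegenerate_at f P.

Let P_SPD : SPD P := P_min.1.

Let f_diff : \forall X \near P, differentiable f X.
Proof. by have [d _ _] := f_C2; apply: filterS (near_SPD P_SPD) => X /d. Qed.

Let df_diff Y : \forall X \near P, differentiable (fun X' => 'd f X' Y : R) X.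
Proof. by have [_ d _] := f_C2; apply: filterS (near_SPD P_SPD) => X /d. Qed.

Let df_diffP Y : differentiable (fun X => 'd f X Y : R) P.
Proof. by have [_ + _] := f_C2; exact. Qed.

Let euclid_hessE Y Z : frob Y (euclid_hess f P Z) = 'd (fun X => 'd f X Y : R) P Z.
Proof. exact: frob_euclid_hess. Qed.

Lemma euclid_hess_mx_sym :
  (operator_mx Q (euclid_hess f P))^T = operator_mx Q (euclid_hess f P).
Proof.
apply/matrixP => k h; rewrite !mxE !euclid_hessE; apply: second_derivative_sym => //.
by move=> W W'; have [_ _] := f_C2; exact.
Qed.

Lemma euclid_hess_mx_posdef : posdef (operator_mx Q (euclid_hess f P)).
Proof.
move=> v v0; pose Y := \sum_k v 0 k *: basis k.
have -> : dot (v *m operator_mx Q (euclid_hess f P)) v = frob Y (euclid_hess f P Y).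
  have hessE : euclid_hess f P Y = \sum_h v 0 h *: euclid_hess f P (basis h).
    rewrite /euclid_hess /Y linear_sum; apply: eq_bigr => h _.
    by rewrite linearZ.
  rewrite dotE hessE linear_sum; apply: eq_bigr => h _.
  rewrite linearZ/= mulrC; congr (_ * _); rewrite mxE frobC linear_sum.
  by apply: eq_bigr => k _; rewrite linearZ/= mxE frobC.
by apply: P_nondeg; apply: contra_neq v0 => /eigenbasis_free.
Qed.

Lemma riem_hess_mx (a : R) l nabla : is_levi_civita SPD (@procrustes_metric R n a) nabla ->
    is_spectral P Q l ->
  operator_mx Q (riem_hess (@procrustes_metric R n a) nabla f P) =
  diag_mx (\row_k inverse_metric_symbol a (l 0 (enum_val k).1) (l 0 (enum_val k).2)) *m
  operator_mx Q (euclid_hess f P).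
Proof.
move=> LC PQ.
have df0 : forall Y, 'd f P Y = 0 :> R.
  apply: diff_local_min => //.
  have [_ P_le] := P_min.
  by apply: filterS (filterI P_le (near_SPD P_SPD)) => X [fX]; exact: fX.
have [grad_diff d_grad] := diff_riem_grad a P_SPD PQ df_diffP df0.
have grad0 : riem_grad (@procrustes_metric R n a) f P = 0.
  rewrite (@riem_grad_schur _ _ a _ _ _ PQ ((SPD_spectral PQ).1 P_SPD) f 0) ?linear0// => Y.
  by rewrite df0 frobC linear0.
rewrite (operator_mx_schur (K := kernelS (inverse_metric_symbolC a) l)
  (T := euclid_hess f P)) => [|Z]; last first.
  by rewrite /riem_hess (covariant_derivative_at_zero Z LC P_SPD grad_diff grad0) d_grad.
by congr (diag_mx _ *m _); apply/rowP => k; rewrite !mxE.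
Qed.

End Hessians.

Lemma powR_div (R : realType) (x y e : R) : 0 < x -> 0 < y ->
  (x / y) `^ e = x `^ e / y `^ e.
Proof.
move=> x0 y0; have ye0 : y `^ e != 0 by rewrite gt_eqF// powR_gt0.
by apply: (mulIf ye0); rewrite divfK// -powRM ?divfK ?gt_eqF// ?divr_ge0 ?ltW.
Qed.

Theorem mainTheorem2 (R : realType) (n : nat) (n_gt0 : (0 < n)%N)
    (nabla : R -> Sym R n -> Sym R n -> (Sym R n -> Sym R n) -> Sym R n)
    (nablaP : forall a : R,
       is_levi_civita SPD (@procrustes_metric R n a) (nabla a))
    (f : Sym R n -> R)
    (fC2 : twice_continuously_differentiable_on SPD f)
    (Pstar : Sym R n)
    (Pstar_min : local_minimizer_on SPD f Pstar)
    (Pstar_nondeg : nondegenerate_at f Pstar)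
    (Q : 'M[R]_n) (lambda : 'rV[R]_n)
    (QP : is_spectral Pstar Q lambda)
    (alpha : R) (alpha_neq1 : alpha != 1) :
  let HE := operator_mx Q (euclid_hess f Pstar) in
  let H (a : R) :=
    operator_mx Q (riem_hess (@procrustes_metric R n a) (nabla a) f Pstar) in
  kappa (H alpha) >= kappa (val Pstar) `^ (2 * `|alpha - 1|) / kappa HE /\
  (kappa (val Pstar) > (Num.sqrt 2 * kappa HE) `^ (`|alpha - 1|^-1) ->
   kappa (H 1) < kappa (H alpha)).
Proof.
move=> HE H; have [QQ PE] := QP.
have l_gt0 := (SPD_spectral QP).1 Pstar_min.1.
pose weight a : 'rV[R]_#|basis_index n| :=
  \row_k inverse_metric_symbol a (lambda 0 (enum_val k).1) (lambda 0 (enum_val k).2).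
have HaE a : H a = diag_mx (weight a) *m HE by exact: riem_hess_mx.
have HE_sym : HE^T = HE by exact: euclid_hess_mx_sym.
have HE_pos : posdef HE by exact: euclid_hess_mx_posdef.
have weight_gt0 a k : 0 < weight a 0 k by rewrite mxE inverse_metric_symbol_gt0.
have diag_index i : (i, i) \in basis_index n by rewrite inE /=.
pose diag_pos i := enum_rank_in (diag_index i) (i, i).
have weight_diag a i : weight a 0 (diag_pos i) = lambda 0 i `^ (2 * (1 - a)).
  by rewrite mxE enum_rankK_in//= inverse_metric_symbol_diag.
have m_gt0 : (0 < #|basis_index n|)%N.
  by apply/card_gt0P; exists (Ordinal n_gt0, Ordinal n_gt0).
have [i [j [supP infP _]]] := extremal_eigenvalues n_gt0 lambda QQ.
have kappaP : kappa (val Pstar) = lambda 0 i / lambda 0 j.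
  by rewrite /kappa PE supP infP.
have kappaHE := kappa_ge1 m_gt0 HE_sym HE_pos.
have kappaHE0 : 0 < kappa HE by exact: lt_le_trans kappaHE.
have lower_bound : kappa (val Pstar) `^ (2 * `|alpha - 1|) / kappa HE <= kappa (H alpha).
  rewrite HaE kappaP (powR_div _ (l_gt0 i) (l_gt0 j)).
  have [a1|a1] := leP alpha 1.
    have norm_a : `|alpha - 1| = 1 - alpha by rewrite ler0_norm ?subr_le0// opprB.
    rewrite norm_a -!weight_diag.
    exact: (kappa_scaling_ge m_gt0 HE_sym HE_pos (weight_gt0 alpha)).
  have -> : 2 * `|alpha - 1| = - (2 * (1 - alpha)).
    by rewrite gtr0_norm ?subr_gt0// -mulrN opprB.
  (* The extremal eigenvalues of P exchange their roles when the exponent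
     changes sign. *)
  rewrite !powRN invrK [X in X / _]mulrC -!weight_diag.
  exact: (kappa_scaling_ge m_gt0 HE_sym HE_pos (weight_gt0 alpha)).
split; first exact: lower_bound.
move=> kappa_large; apply: lt_le_trans lower_bound.
have H1_le : kappa (H 1) <= 2 * kappa HE.
  rewrite HaE -[X in X * _]divr1.
  apply: (kappa_scaling_le m_gt0 HE_sym HE_pos (weight_gt0 1)) => // k.
  by rewrite mxE inverse_metric_symbol1_bounds.
(* The hypothesis raised to the power 2 |alpha - 1| is 2 kappa(HE)^2 < kappa(P)^(2 |alpha - 1|). *)
rewrite (le_lt_trans H1_le)// ltr_pdivlMr//.
set b := `|alpha - 1| in kappa_large *.
have b0 : 0 < b by rewrite normr_gt0 subr_eq0.
have -> : 2 * kappa HE * kappa HE = ((Num.sqrt 2 * kappa HE) `^ b^-1) `^ (2 * b).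
  have exponent : b^-1 * (2 * b) = 2 by field; rewrite gt_eqF.
  rewrite -powRrM exponent powR_mulrn//; last first.
    exact: mulr_ge0 (sqrtr_ge0 _) (ltW kappaHE0).
  by rewrite exprMn sqr_sqrtr// expr2 mulrA.
have b2 : 0 < 2 * b by exact: mulr_gt0.
apply: (gt0_ltr_powR b2 _ _ kappa_large); rewrite nnegrE ?powR_ge0//.
by rewrite kappaP divr_ge0// ltW.
Qed.
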